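(* Let $f\in L^1(\mathbb{R}^2,\mathbb{H})$ and let $\mathcal{F}_R(u,v)=\int_{\mathbb{R}^2}f(s,t)e^{-\mathbf{i}us}e^{-\mathbf{j}vt}\,ds\,dt$ be its right-sided quaternion Fourier transform. If $\mathcal{F}_R\in L^1(\mathbb{R}^2,\mathbb{H})$, then $$f(s,t)=\frac{1}{4\pi^2}\int_{\mathbb{R}^2}\mathcal{F}_R(u,v)e^{\mathbf{j}tv}e^{\mathbf{i}su}\,du\,dv$$ for almost every $(s,t)\in\mathbb{R}^2$.
   Context: $\mathbb{H}$ is the algebra of quaternions $q=q_0+\mathbf{i}q_1+\mathbf{j}q_2+\mathbf{k}q_3$ ($q_n\in\mathbb{R}$) with the usual Hamilton multiplication ($\mathbf{i}\mathbf{j}=-\mathbf{j}\mathbf{i}=\mathbf{k}$, etc.) and modulus $|q|=(q_0^2+q_1^2+q_2^2+q_3^2)^{1/2}$; $e^{\mathbf{i}\theta}=\cos\theta+\mathbf{i}\sin\theta$ and likewise for $\mathbf{j}$. $L^1(\mathbb{R}^2,\mathbb{H})$ is the space of $f:\mathbb{R}^2\to\mathbb{H}$ with $\int_{\mathbb{R}^2}|f|\,ds\,dt<\infty$; integrals are taken componentwise. *)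

(* Defs.v *)
From HB Require Import structures.
From mathcomp Require Import all_boot all_order all_algebra ring.
From mathcomp Require Import all_classical all_reals all_analysis.
Set Implicit Arguments.
Unset Strict Implicit.
Unset Printing Implicit Defensive.
Import Order.TTheory GRing.Theory Num.Theory.
Import numFieldNormedType.Exports.
Local Open Scope classical_set_scope.
Local Open Scope ring_scope.

Record quaternion (R : Type) := Quat { q0 : R; q1 : R; q2 : R; q3 : R }.

Section QuaternionAlgebra.
Variable R : comNzRingType.
Local Notation H := (quaternion R).

Definition quat_to (q : H) := (q0 q, q1 q, q2 q, q3 q).
Definition quat_of (x : R * R * R * R) : H :=
  let: (a, b, c, d) := x in Quat a b c d.
Lemma quat_toK : cancel quat_to quat_of. Proof. by case. Qed.

HB.instance Definition _ := Choice.copy H (can_type quat_toK).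

Definition addq (p q : H) : H :=
  Quat (q0 p + q0 q) (q1 p + q1 q) (q2 p + q2 q) (q3 p + q3 q).
Definition oppq (q : H) : H := Quat (- q0 q) (- q1 q) (- q2 q) (- q3 q).
Definition mulq (p q : H) : H :=
  Quat (q0 p * q0 q - q1 p * q1 q - q2 p * q2 q - q3 p * q3 q)
       (q0 p * q1 q + q1 p * q0 q + q2 p * q3 q - q3 p * q2 q)
       (q0 p * q2 q - q1 p * q3 q + q2 p * q0 q + q3 p * q1 q)
       (q0 p * q3 q + q1 p * q2 q - q2 p * q1 q + q3 p * q0 q).
Definition scaleq (a : R) (q : H) : H :=
  Quat (a * q0 q) (a * q1 q) (a * q2 q) (a * q3 q).

Lemma addqA : associative addq.
Proof. by move=> x y z; congr Quat; rewrite /= addrA. Qed.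
Lemma addqC : commutative addq.
Proof. by move=> x y; congr Quat; rewrite /= addrC. Qed.
Lemma add0q : left_id (Quat 0 0 0 0) addq.
Proof. by case=> *; congr Quat; rewrite /= add0r. Qed.
Lemma addNq : left_inverse (Quat 0 0 0 0) oppq addq.
Proof. by move=> x; congr Quat; rewrite /= addNr. Qed.

HB.instance Definition _ := GRing.isZmodule.Build H addqA addqC add0q addNq.

Lemma mulqA : associative mulq.
Proof. by move=> x y z; congr Quat => /=; ring. Qed.
Lemma mul1q : left_id (Quat 1 0 0 0) mulq.
Proof. by case=> *; congr Quat => /=; ring. Qed.
Lemma mulq1 : right_id (Quat 1 0 0 0) mulq.
Proof. by case=> *; congr Quat => /=; ring. Qed.
Lemma mulqDl : left_distributive mulq addq.
Proof. by move=> x y z; congr Quat => /=; ring. Qed.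
Lemma mulqDr : right_distributive mulq addq.
Proof. by move=> x y z; congr Quat => /=; ring. Qed.
Lemma oneq_neq0 : Quat 1 0 0 0 != 0 :> H.
Proof. by apply/eqP => -[] /eqP; rewrite oner_eq0. Qed.

HB.instance Definition _ := GRing.Zmodule_isNzRing.Build H
  mulqA mul1q mulq1 mulqDl mulqDr oneq_neq0.

Lemma scaleqA a b (q : H) : scaleq a (scaleq b q) = scaleq (a * b) q.
Proof. by congr Quat; rewrite /= mulrA. Qed.
Lemma scale1q : left_id 1 scaleq.
Proof. by case=> *; congr Quat; rewrite /= mul1r. Qed.
Lemma scaleqDr : right_distributive scaleq +%R.
Proof. by move=> a p q; congr Quat; rewrite /= mulrDr. Qed.
Lemma scaleqDl (q : H) : {morph scaleq^~ q : a b / a + b}.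
Proof. by move=> a b; congr Quat; rewrite /= mulrDl. Qed.

HB.instance Definition _ := GRing.Zmodule_isLmodule.Build R H
  scaleqA scale1q scaleqDr scaleqDl.

Lemma scaleqAl (a : R) (p q : H) : a *: (p * q) = (a *: p) * q.
Proof. by congr Quat => /=; ring. Qed.

HB.instance Definition _ := GRing.Lmodule_isLalgebra.Build R H scaleqAl.

Definition qi : H := Quat 0 1 0 0.
Definition qj : H := Quat 0 0 1 0.
Definition qk : H := Quat 0 0 0 1.

Lemma qi_qj : qi * qj = qk. Proof. by congr Quat => /=; ring. Qed.
Lemma qj_qi : qj * qi = - qk. Proof. by congr Quat => /=; ring. Qed.
Lemma qj_qk : qj * qk = qi. Proof. by congr Quat => /=; ring. Qed.
Lemma qk_qi : qk * qi = qj. Proof. by congr Quat => /=; ring. Qed.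
Lemma qi_sqr : qi * qi = -1. Proof. by congr Quat => /=; ring. Qed.
Lemma qj_sqr : qj * qj = -1. Proof. by congr Quat => /=; ring. Qed.
Lemma qk_sqr : qk * qk = -1. Proof. by congr Quat => /=; ring. Qed.

End QuaternionAlgebra.
Arguments qi {R}.
Arguments qj {R}.
Arguments qk {R}.

Section QuaternionFourier.
Variable R : realType.
Local Notation H := (quaternion R).

Definition normq (q : H) : R :=
  Num.sqrt (q0 q ^+ 2 + q1 q ^+ 2 + q2 q ^+ 2 + q3 q ^+ 2).

Definition expi (theta : R) : H := (cos theta)%:A + sin theta *: qi.
Definition expj (theta : R) : H := (cos theta)%:A + sin theta *: qj.

Definition leb2 : {measure set (measurableTypeR R * measurableTypeR R) -> \bar R} :=
  (@lebesgue_measure R \x @lebesgue_measure R)%E.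

Definition measurable_quat (f : R * R -> H) : Prop :=
  [/\ measurable_fun setT (fun x => q0 (f x)),
      measurable_fun setT (fun x => q1 (f x)),
      measurable_fun setT (fun x => q2 (f x)) &
      measurable_fun setT (fun x => q3 (f x))].

(* The library's sigma-algebra on R * R is the Borel one, so a function is
   Lebesgue measurable iff it agrees a.e. with a [measurable_quat] function.
   The library integral of a function that is only Lebesgue measurable is still
   its Lebesgue integral: the supremum over Borel simple functions below a
   nonnegative function does not see null sets. *)
Definition L1_quat (f : R * R -> H) : Prop :=
  (exists2 g : R * R -> H,
     measurable_quat g & {ae leb2, forall x, f x = g x}) /\
  (\int[leb2]_x (normq (f x))%:E < +oo)%E.

Definition integral_quat (f : R * R -> H) : H :=
  Quat (Rintegral leb2 setT (fun x => q0 (f x)))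
       (Rintegral leb2 setT (fun x => q1 (f x)))
       (Rintegral leb2 setT (fun x => q2 (f x)))
       (Rintegral leb2 setT (fun x => q3 (f x))).

Definition right_QFT (f : R * R -> H) (w : R * R) : H :=
  integral_quat (fun x => f x * expi (- (w.1 * x.1)) * expj (- (w.2 * x.2))).

End QuaternionFourier.
Arguments leb2 : clear implicits.

(* Main.v *)
Require Import Defs.
From HB Require Import structures.
From mathcomp Require Import all_boot all_order all_algebra.
From mathcomp Require Import all_classical all_reals all_analysis.
From mathcomp Require Import measurable_realfun ring lra.
Import Order.TTheory GRing.Theory Num.Theory.
Import numFieldNormedType.Exports.
Set Implicit Arguments.
Unset Strict Implicit.
Unset Printing Implicit Defensive.
Local Open Scope classical_set_scope.
Local Open Scope ring_scope.

(** The inversion formula is proved by Abel summation, tested on rectangles.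

    Let F be the transform of f, and insert the factor
    [abel2 r (u, v) = exp (- r |u|) exp (- r |v|)], r > 0, in the inverse integral.
    This makes the double integral over frequencies and positions absolutely
    convergent, so F may be replaced by its definition and the integrations
    exchanged. In the product
      f(x, y) exp(- i u x) exp(- j v y) exp(j t v) exp(i s u)
    the two j-exponentials are adjacent. Integrated over v against exp (- r |v|) they
    give [poisson r (t - y)], a real number because the sine part is odd; being real
    it can be moved aside, the two i-exponentials become adjacent in turn, and their
    integral over u is [poisson r (s - x)]. So the Abel mean of the inverse integral is
    the convolution of f with a product of two Poisson kernels (up to the factor
    4 pi ^ 2): see [qint_abel2_kernel] and [inv_QFT_abel].

    The limit r -> 0 is taken after integration over a rectangle ]a, b] x ]c, d].
    On one side, the integral of a Poisson kernel over an interval is a difference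
    of two arctangents, which is bounded and tends to 2 pi times the indicator of
    the interval except at its ends; by dominated convergence the integral tends to
    4 pi ^ 2 times that of f over the rectangle ([cvg_Rintegral_smoothed_rect]). On the
    other side F is integrable, so the Abel means are uniformly bounded and converge
    everywhere to the inverse integral without the factor
    ([cvg_rect_inv_QFT_abel]). Hence f and the inverse transform of F have the same
    integrals over all rectangles, and two such functions agree almost everywhere
    ([ae_eq_rectangles], a pi-lambda argument).

    A function in L1 is only almost everywhere equal to a Borel function; since an
    integral does not see null sets ([eq_integral_ae]), f and F are first
    replaced by Borel representatives. *)

(* [rat] exports another [normq]. *)
Local Notation normq := Defs.normq.

(** * Coordinates of quaternions *)

Section Coordinates.
Variable R : comNzRingType.
Implicit Types p q : quaternion R.

(** Indexing the coordinates by ['I_4] lets every componentwise argument be made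
    once, for a generic index. *)
Definition qcoord (k : 'I_4) q : R := nth 0 [:: q0 q; q1 q; q2 q; q3 q] k.

Definition qbasis (k : 'I_4) : quaternion R := nth 0 [:: 1; qi; qj; qk] k.

Lemma qcoord_inj p q : (forall k, qcoord k p = qcoord k q) -> p = q.
Proof.
case: p q => [a b c d] [a' b' c' d'] h.
by have := (h (inord 0), h (inord 1), h (inord 2), h (inord 3));
  rewrite /qcoord !inordK//= => -[[[-> ->] ->] ->].
Qed.

Lemma qcoordD k p q : qcoord k (p + q) = qcoord k p + qcoord k q.
Proof. by case: k => [[|[|[|[|]]]]]. Qed.

Lemma qcoordZ k (a : R) q : qcoord k (a *: q) = a * qcoord k q.
Proof. by case: k => [[|[|[|[|]]]]]. Qed.

(** This expansion in the basis reduces products of quaternion-valued functions to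
    finite sums of products of real functions. *)
Lemma qcoordM k p q : qcoord k (p * q) =
  \sum_i \sum_j qcoord i p * qcoord j q * qcoord k (qbasis i * qbasis j).
Proof.
by case: k => [[|[|[|[|]]]]] //= ?; rewrite !big_ord_recl !big_ord0 /qcoord/=; ring.
Qed.

Lemma scaleqAr (a : R) p q : a *: (p * q) = p * (a *: q).
Proof. by congr Quat => /=; ring. Qed.

End Coordinates.

(** * Componentwise integrals *)

Section QuaternionIntegral.
Context d (T : measurableType d) (R : realType).
Implicit Types (mu : {measure set T -> \bar R}) (f g : T -> quaternion R).

Definition qmeasurable f := forall k, measurable_fun setT (fun x => qcoord k (f x)).

Definition qbounded f := exists M : R, forall k x, `|qcoord k (f x)| <= M.

Definition qintegrable mu f :=
  forall k, mu.-integrable setT (EFin \o (fun x => qcoord k (f x))).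

Definition qint mu f : quaternion R :=
  Quat (Rintegral mu setT (fun x => q0 (f x)))
       (Rintegral mu setT (fun x => q1 (f x)))
       (Rintegral mu setT (fun x => q2 (f x)))
       (Rintegral mu setT (fun x => q3 (f x))).

Lemma qcoord_qint mu f k :
  qcoord k (qint mu f) = Rintegral mu setT (fun x => qcoord k (f x)).
Proof. by case: k => [[|[|[|[|]]]]]. Qed.

Lemma qintegrable_measurable mu f : qintegrable mu f -> qmeasurable f.
Proof. by move=> fi k; apply/measurable_EFinP; exact: measurable_int (fi k). Qed.

Lemma qmeasurable_cst q : qmeasurable (cst q).
Proof. by move=> k; rewrite /cst; exact: measurable_cst. Qed.

Lemma qbounded_cst q : qbounded (cst q).
Proof.
by exists (\sum_k `|qcoord k q|) => k x; rewrite (bigD1 k)//= lerDl sumr_ge0.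
Qed.

Lemma qmeasurableM f g :
  qmeasurable f -> qmeasurable g -> qmeasurable (fun x => f x * g x).
Proof.
move=> mf mg k; under eq_fun do rewrite qcoordM.
apply: measurable_sum => i; apply: measurable_sum => j.
by apply: measurable_funM; [apply: measurable_funM|exact: measurable_cst].
Qed.

Lemma qmeasurableZ (a : T -> R) f : measurable_fun setT a ->
  qmeasurable f -> qmeasurable (fun x => a x *: f x).
Proof.
by move=> ma mf k; under eq_fun do rewrite qcoordZ; apply: measurable_funM.
Qed.

Lemma qboundedM f g :
  qbounded f -> qbounded g -> qbounded (fun x => f x * g x).
Proof.
move=> [M fM] [N gN].
exists (\sum_(l < 4) \sum_(i < 4) \sum_(j < 4)
  M * N * `|qcoord l (qbasis R i * qbasis R j)|).
have M0 (x : T) : 0 <= M by rewrite (le_trans _ (fM ord0 x)).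

have N0 (x : T) : 0 <= N by rewrite (le_trans _ (gN ord0 x)).
move=> k x; rewrite qcoordM [leRHS](bigD1 k)//= ler_wpDr//.
  do 3 (apply: sumr_ge0 => ? _); apply: mulr_ge0 => //.
  by rewrite mulr_ge0 ?M0 ?N0.
apply: le_trans (ler_norm_sum _ _ _) _; apply: ler_sum => i _.
apply: le_trans (ler_norm_sum _ _ _) _; apply: ler_sum => j _.
by rewrite !normrM ler_wpM2r// ler_pM.
Qed.

(** In coordinates, a finite sum of products of an integrable and a bounded
    measurable function. *)
Lemma qintegrableMr mu f g : qintegrable mu f -> qmeasurable g -> qbounded g ->
  qintegrable mu (fun x => f x * g x).
Proof.
move=> fi mg [M gM] k.
have -> : EFin \o (fun x => qcoord k (f x * g x)) = fun x => (\sum_i \sum_j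
    ((qcoord i (f x))%:E * (qcoord j (g x) * qcoord k (qbasis R i * qbasis R j))%:E))%E.
  apply/funext => x /=; rewrite qcoordM -sumEFin; apply: eq_bigr => i _.
  by rewrite -sumEFin; apply: eq_bigr => j _; rewrite -EFinM mulrA.
apply: integrable_sum => // i _; apply: integrable_sum => // j _.
apply: integrableMl => //.
- exact: fi.
- by apply: measurable_funM; [exact: mg|exact: measurable_cst].
exists (M * `|qcoord k (qbasis R i * qbasis R j)|); split; first exact: num_real.
by move=> N MN x _ /=; rewrite normrM (le_trans _ (ltW MN))// ler_wpM2r.
Qed.

Lemma qintegrableMl mu f g : qintegrable mu f -> qmeasurable g -> qbounded g ->
  qintegrable mu (fun x => g x * f x).
Proof.
move=> fi mg [M gM] k.
have -> : EFin \o (fun x => qcoord k (g x * f x)) = fun x => (\sum_i \sum_j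
    ((qcoord j (f x))%:E * (qcoord i (g x) * qcoord k (qbasis R i * qbasis R j))%:E))%E.
  apply/funext => x /=; rewrite qcoordM -sumEFin; apply: eq_bigr => i _.
  by rewrite -sumEFin; apply: eq_bigr => j _; rewrite -EFinM mulrA (mulrC (qcoord j _)).
apply: integrable_sum => // i _; apply: integrable_sum => // j _.
apply: integrableMl => //.
- exact: fi.
- by apply: measurable_funM; [exact: mg|exact: measurable_cst].
exists (M * `|qcoord k (qbasis R i * qbasis R j)|); split; first exact: num_real.
by move=> N MN x _ /=; rewrite normrM (le_trans _ (ltW MN))// ler_wpM2r.
Qed.

Lemma integrable_EFin_sum mu (I : Type) (s : seq I) (h : I -> T -> R) :
  (forall i, mu.-integrable setT (EFin \o h i)) ->
  mu.-integrable setT (EFin \o (fun x => \sum_(i <- s) h i x)).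
Proof.
move=> hi; have -> : EFin \o (fun x => \sum_(j <- s) h j x) =
    (fun x => \sum_(j <- s) (h j x)%:E)%E.
  by apply/funext => x /=; rewrite sumEFin.
by apply: integrable_sum => // j _; exact: hi.
Qed.

Lemma Rintegral_sum mu (I : Type) (s : seq I) (h : I -> T -> R) :
  (forall i, mu.-integrable setT (EFin \o h i)) ->
  Rintegral mu setT (fun x => \sum_(i <- s) h i x) =
  \sum_(i <- s) Rintegral mu setT (h i).
Proof.
move=> hi; elim: s => [|i s ih].
  under eq_Rintegral do rewrite big_nil.
  by rewrite big_nil /Rintegral integral0.
under eq_Rintegral do rewrite big_cons.
by rewrite big_cons RintegralD ?ih//; exact: integrable_EFin_sum.
Qed.

Lemma integrable_EFinZr mu (a : T -> R) (c : R) : mu.-integrable setT (EFin \o a) ->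
  mu.-integrable setT (EFin \o (fun x => a x * c)).
Proof.
move=> ai; apply: eq_integrable (integrableZl measurableT c ai) => // x _ /=.
by rewrite -EFinM mulrC.
Qed.

Lemma integrable_EFinD mu (a b : T -> R) :
  mu.-integrable setT (EFin \o a) -> mu.-integrable setT (EFin \o b) ->
  mu.-integrable setT (EFin \o (fun x => a x + b x)).
Proof. by move=> ai bi; have := integrableD measurableT ai bi. Qed.

Lemma integrable_qcoord_mulr mu f k (a : R) : qintegrable mu f ->
  mu.-integrable setT (EFin \o (fun x => qcoord k (f x) * a)).
Proof. by move=> fi; apply: integrable_EFinZr; exact: fi. Qed.

(** Right multiplication by a constant is linear in the coordinates. The left-hand
    version [qint_mull] is a separate fact, as the multiplication is not
    commutative. *)
Lemma qint_mulr mu f c : qintegrable mu f ->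
  qint mu (fun x => f x * c) = qint mu f * c.
Proof.
move=> fi; apply: qcoord_inj => k; rewrite qcoord_qint qcoordM.
under eq_Rintegral => x _.
  rewrite qcoordM; under eq_bigr do under eq_bigr do rewrite -mulrA.
  over.
rewrite Rintegral_sum => [|i]; last first.
  by apply: integrable_EFin_sum => j; exact: integrable_qcoord_mulr.
apply: eq_bigr => i _; rewrite Rintegral_sum => [|j]; last first.
  exact: integrable_qcoord_mulr.
by apply: eq_bigr => j _; rewrite RintegralZr ?qcoord_qint ?mulrA//; exact: fi.
Qed.

Lemma qint_mull mu f c : qintegrable mu f ->
  qint mu (fun x => c * f x) = c * qint mu f.
Proof.
move=> fi; apply: qcoord_inj => k; rewrite qcoord_qint qcoordM.
under eq_Rintegral => x _.
  rewrite qcoordM.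
  under eq_bigr do under eq_bigr do rewrite (mulrC (qcoord _ c)) -mulrA.
  over.
rewrite Rintegral_sum => [|i]; last first.
  by apply: integrable_EFin_sum => j; exact: integrable_qcoord_mulr.
apply: eq_bigr => i _; rewrite Rintegral_sum => [|j]; last first.
  exact: integrable_qcoord_mulr.
apply: eq_bigr => j _; rewrite RintegralZr; [|by []|exact: fi].
by rewrite qcoord_qint mulrA (mulrC (qcoord _ c)).
Qed.

Lemma qintZ mu f (a : R) : qintegrable mu f ->
  qint mu (fun x => a *: f x) = a *: qint mu f.
Proof.
move=> fi; apply: qcoord_inj => k; rewrite qcoord_qint qcoordZ qcoord_qint.
by under eq_Rintegral do rewrite qcoordZ; rewrite RintegralZl.
Qed.

Lemma qintegrableZ mu f (a : T -> R) : qintegrable mu f ->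
  measurable_fun setT a -> (exists M : R, forall x, `|a x| <= M) ->
  qintegrable mu (fun x => a x *: f x).
Proof.
move=> fi ma [M aM] k.
have -> : EFin \o (fun x => qcoord k (a x *: f x)) =
    ((EFin \o a) \* (EFin \o (fun x => qcoord k (f x))))%E.
  by apply/funext => x /=; rewrite qcoordZ.
apply: integrableMr => //.
exists M; split; first exact: num_real.
by move=> N MN x _ /=; rewrite (le_trans _ (ltW MN)).
Qed.

Lemma eq_qint mu f g : f =1 g -> qint mu f = qint mu g.
Proof. by move=> fg; congr qint; apply/funext. Qed.

End QuaternionIntegral.

(** * Null sets, dominated convergence and Fubini's theorem *)

Section AlmostEverywhere.
Context d (T : measurableType d) (R : realType) (mu : {measure set T -> \bar R}).
Import HBNNSimple.

(** The integral of a nonnegative function, measurable or not, is the supremum of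
    the integrals of the simple functions below it; setting such a simple function
    to 0 on [N] does not change its integral and puts it below [g]. *)
Lemma ge0_le_integral_negligible (f g : T -> \bar R) (N : set T) :
  measurable N -> mu N = 0%E ->
  (forall x, 0 <= f x)%E -> (forall x, 0 <= g x)%E ->
  (forall x, ~ N x -> f x <= g x)%E ->
  (\int[mu]_x f x <= \int[mu]_x g x)%E.
Proof.
move=> mN N0 f0 g0 fg; rewrite !ge0_integralTE//.
apply: ge_ereal_sup => _ [h /= hf <-]; apply: ereal_sup_ubound => /=.
have hNE : proj_nnsfun h (measurableC mN) = h \_ (~` N) :> (T -> R).
  by rewrite (mrestrict h (measurableC mN)).
exists (proj_nnsfun h (measurableC mN)) => [x|].
  rewrite hNE patchE; case: ifPn => [|_]; last exact: g0.
  by rewrite inE => /fg; exact/le_trans/hf.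
rewrite -!integralT_nnsfun; apply: ge0_ae_eq_integral => //.
- by apply/measurable_EFinP; exact: measurable_funP.
- by apply/measurable_EFinP; exact: measurable_funP.
- by move=> x _; rewrite lee_fin.
- by move=> x _; rewrite lee_fin.
exists N; split => // x /= /not_implyP[_]; apply: contra_notP => Nx.
by rewrite /mindic indicE mem_set ?mulr1.
Qed.

(** This allows a function that is merely almost everywhere equal to a Borel
    function to be replaced by it in an integral. *)
Lemma eq_integral_ae (f g : T -> \bar R) :
  {ae mu, forall x, f x = g x} -> (\int[mu]_x f x = \int[mu]_x g x)%E.
Proof.
move=> [N [mN N0 fgN]].
have {fgN}fg x : ~ N x -> f x = g x by move=> Nx; apply: contrapT => /fgN.
rewrite integralE [RHS]integralE; congr (_ - _)%E; apply/eqP; rewrite eq_le;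
  by apply/andP; split; apply: (ge0_le_integral_negligible mN N0) => // x Nx;
  rewrite ?funeposE ?funenegE fg.
Qed.

Lemma eq_Rintegral_ae (f g : T -> R) :
  {ae mu, forall x, f x = g x} -> Rintegral mu setT f = Rintegral mu setT g.
Proof.
by move=> fg; congr fine; apply: eq_integral_ae; apply: filterS fg => x ->.
Qed.

Lemma eq_qint_ae (f g : T -> quaternion R) :
  {ae mu, forall x, f x = g x} -> qint mu f = qint mu g.
Proof.
by move=> fg; congr Quat; apply: eq_Rintegral_ae; apply: filterS fg => x ->.
Qed.

Lemma Rintegral_indicM (D : set T) (f : T -> R) :
  Rintegral mu setT (fun x => \1_D x * f x) = Rintegral mu D f.
Proof.
rewrite [RHS]Rintegral_mkcond; apply: eq_Rintegral => x _; rewrite indicE patchE.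
by case: ifPn => _; rewrite ?mul1r ?mul0r.
Qed.

Lemma integrable_indicM (D : set T) (f : T -> R) : measurable D ->
  mu.-integrable setT (EFin \o f) ->
  mu.-integrable setT (EFin \o (fun x => \1_D x * f x)).
Proof.
move=> mD fi; have mf : measurable_fun setT f.
  by apply/measurable_EFinP; exact: measurable_int fi.
apply: le_integrable fi => //.
  by apply/measurable_EFinP; apply: measurable_funM => //; exact: measurable_indic.
move=> x _; rewrite lee_fin normrM ler_piMl// indicE.
by case: (_ \in _); rewrite ?normr1 ?normr0.
Qed.

Lemma dominated_Rintegral (f_ : nat -> T -> R) (f g : T -> R) :
  (forall n, measurable_fun setT (f_ n)) -> measurable_fun setT f ->
  {ae mu, forall x, f_ n x @[n --> \oo] --> f x} ->
  mu.-integrable setT (EFin \o g) ->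
  (forall n x, `|f_ n x| <= g x) ->
  Rintegral mu setT (f_ n) @[n --> \oo] --> Rintegral mu setT f.
Proof.
move=> mf_ mf f_f gi f_g.
have [n|||||fi _ cv] := @dominated_convergence _ T R mu setT measurableT
  (fun n => EFin \o f_ n) (EFin \o f) (EFin \o g).
- exact/measurable_EFinP.
- exact/measurable_EFinP.
- apply: filterS f_f => x h _; apply: cvg_EFin => //.
  exact: nearW.
- exact: gi.
- by apply: aeW => x n _; rewrite lee_fin.
apply: fine_cvg; rewrite /Rintegral fineK//; exact: integrable_fin_num.
Qed.

End AlmostEverywhere.

Section RealFubini.
Context d1 d2 (X : measurableType d1) (Y : measurableType d2) (R : realType).
Variables (m1 : {sigma_finite_measure set X -> \bar R}).
Variables (m2 : {sigma_finite_measure set Y -> \bar R}).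

Lemma integrable_prodM (a : X -> R) (b : Y -> R) :
  m1.-integrable setT (EFin \o a) -> m2.-integrable setT (EFin \o b) ->
  (m1 \x m2)%E.-integrable setT (EFin \o (fun z => a z.1 * b z.2)).
Proof.
move=> ai bi.
have ma : measurable_fun setT a by apply/measurable_EFinP; exact: measurable_int ai.
have mb : measurable_fun setT b by apply/measurable_EFinP; exact: measurable_int bi.
apply/integrable12ltyP.
  apply/measurable_EFinP; apply: measurable_funM.
  - exact: (measurableT_comp ma).
  - exact: (measurableT_comp mb).
under eq_integral => x _.
  under eq_integral => y _ do rewrite /= normrM EFinM.
  rewrite ge0_integralZl_EFin//; last first.
    by apply/measurable_EFinP; exact: measurableT_comp.
  over.
have afin : (\int[m1]_x `|a x|%:E \is a fin_num)%E.
  by rewrite ge0_fin_numE ?integral_ge0//; case/integrableP : ai.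
have bfin : (\int[m2]_y `|b y|%:E \is a fin_num)%E.
  by rewrite ge0_fin_numE ?integral_ge0//; case/integrableP : bi.
rewrite -(fineK bfin) ge0_integralZr//.
- by rewrite -(fineK afin) -EFinM ltry.
- by apply/measurable_EFinP; exact: measurableT_comp.
- by rewrite lee_fin fine_ge0// integral_ge0.
Qed.

(** [Rintegral] replaces an infinite inner integral by 0, which can only decrease
    its absolute value, so the function is dominated by the extended-real one. *)
Lemma integrable_Rintegral1 (f : X * Y -> R) :
  (m1 \x m2)%E.-integrable setT (EFin \o f) ->
  m1.-integrable setT (EFin \o (fun x => Rintegral m2 setT (fun y => f (x, y)))).
Proof.
move=> fi; have Fi := integrable_fubini_F fi.
apply: le_integrable Fi => //.
  apply/measurable_EFinP; apply: measurableT_comp => //.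
  exact: measurable_fubini_F fi.
by move=> x _; rewrite /Rintegral /fubini_F /=; case: (integral _ _ _) => //= *;
  rewrite ?normr0 ?leey.
Qed.

(** For almost every [x] the inner integral is finite, and there it is not altered
    by the truncation in [Rintegral]. *)
Lemma Rintegral12_prod (f : X * Y -> R) :
  (m1 \x m2)%E.-integrable setT (EFin \o f) ->
  Rintegral m1 setT (fun x => Rintegral m2 setT (fun y => f (x, y))) =
  Rintegral (m1 \x m2)%E setT f.
Proof.
move=> fi; congr fine; rewrite -(integral12_prod_meas1 fi); apply: eq_integral_ae.
apply: filterS (ae_integrable1 fi) => x xi.
by rewrite /Rintegral fineK//; exact: integrable_fin_num.
Qed.

Lemma Rintegral21_prod (f : X * Y -> R) :
  (m1 \x m2)%E.-integrable setT (EFin \o f) ->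
  Rintegral m2 setT (fun y => Rintegral m1 setT (fun x => f (x, y))) =
  Rintegral (m1 \x m2)%E setT f.
Proof.
move=> fi; congr fine; rewrite -(integral21_prod_meas1 fi); apply: eq_integral_ae.
apply: filterS (ae_integrable2 fi) => y yi.
by rewrite /Rintegral fineK//; exact: integrable_fin_num.
Qed.

Lemma Rintegral_prodM (a : X -> R) (b : Y -> R) :
  m1.-integrable setT (EFin \o a) -> m2.-integrable setT (EFin \o b) ->
  Rintegral (m1 \x m2)%E setT (fun z => a z.1 * b z.2) =
  Rintegral m1 setT a * Rintegral m2 setT b.
Proof.
move=> ai bi; rewrite -Rintegral12_prod; last exact: integrable_prodM.
by under eq_Rintegral do rewrite /= RintegralZl//; rewrite RintegralZr.
Qed.

End RealFubini.

Section QuaternionFubini.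
Context d1 d2 (X : measurableType d1) (Y : measurableType d2) (R : realType).
Variables (m1 : {sigma_finite_measure set X -> \bar R}).
Variables (m2 : {sigma_finite_measure set Y -> \bar R}).

Lemma qintegrable_prodZ (a : X -> R) (f : Y -> quaternion R) :
  m1.-integrable setT (EFin \o a) -> qintegrable m2 f ->
  qintegrable (m1 \x m2)%E (fun z => a z.1 *: f z.2).
Proof.
move=> ai fi k.
have -> : (fun z => qcoord k (a z.1 *: f z.2)) = (fun z => a z.1 * qcoord k (f z.2)).
  by apply/funext => z; rewrite qcoordZ.
exact: integrable_prodM (fi k).
Qed.

Variable f : X * Y -> quaternion R.
Hypothesis fi : qintegrable (m1 \x m2)%E f.

Lemma qintegrable_qint1 : qintegrable m1 (fun x => qint m2 (fun y => f (x, y))).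
Proof.
move=> k; under eq_fun do rewrite qcoord_qint.
exact: integrable_Rintegral1 (fi k).
Qed.

Lemma qint12_prod :
  qint m1 (fun x => qint m2 (fun y => f (x, y))) = qint (m1 \x m2)%E f.
Proof.
apply: qcoord_inj => k; rewrite !qcoord_qint -Rintegral12_prod//.
by apply: eq_Rintegral => x _; rewrite qcoord_qint.
Qed.

Lemma qFubini : qint m1 (fun x => qint m2 (fun y => f (x, y))) =
  qint m2 (fun y => qint m1 (fun x => f (x, y))).
Proof.
rewrite qint12_prod; apply: qcoord_inj => k; rewrite !qcoord_qint -Rintegral21_prod//.
by apply: eq_Rintegral => x _; rewrite qcoord_qint.
Qed.

End QuaternionFubini.

(** * The Fourier transform of the Abel kernel *)

Section AbelKernel.
Variable R : realType.
Notation mu := (@lebesgue_measure R).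

(** The summability factor. It is integrable, tends to 1 from below when [r > 0]
    tends to 0, and its Fourier transform is elementary. *)
Definition abel (r u : R) : R := expR (- r * `|u|).

Lemma continuous_abel r : continuous (abel r).
Proof.
move=> u; apply: (continuous_comp (f := fun u => - r * `|u|)); last exact: continuous_expR.
by apply: continuousM; [exact: cst_continuous|exact: norm_continuous].
Qed.

Lemma integralT_reflect (f : R -> R) : (forall x, 0 <= f x) -> continuous f ->
  (\int[mu]_x (f x)%:E =
   \int[mu]_(x in `[0%R, +oo[) (f x)%:E + \int[mu]_(x in `[0%R, +oo[) (f (- x))%:E)%E.
Proof.
move=> f0 cf.
have mf : measurable_fun [set: R] f by exact: continuous_measurable_fun.
rewrite -(setUv `[(0:R), +oo[%classic) ge0_integral_setU//= ; last 4 first.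
- exact: measurableC.
- by apply/measurable_EFinP; rewrite setUv.
- by move=> x _; rewrite lee_fin.
- exact/disj_setPCl.
congr +%E; rewrite setCitvr.
rewrite integral_itv_bndo_bndc; last exact/measurable_EFinP/measurable_funTS.
by rewrite -{1}oppr0 ge0_integration_by_substitutionNy//; exact: continuous_subspaceT.
Qed.

(** Invariance under reflection is what makes the sine parts of the transforms
    vanish. *)
Lemma integralT_opp (f : R -> R) : (forall x, 0 <= f x) -> continuous f ->
  (\int[mu]_x (f (- x))%:E = \int[mu]_x (f x)%:E)%E.
Proof.
move=> f0 cf; rewrite (integralT_reflect f0 cf) (@integralT_reflect (f \o -%R))//.
  by rewrite addeC; congr +%E; apply: eq_integral => x _; rewrite /= opprK.
  by move=> x; exact: f0.
move=> x; apply: (continuous_comp (f := -%R) (g := f)); last exact: cf.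
exact: oppr_continuous.
Qed.

Lemma continuous_cosM (y : R) : continuous (fun u => cos (y * u)).
Proof.
move=> u; apply: (continuous_comp (f := fun u => y * u)); last exact: continuous_cos.
by apply: continuousM; [exact: cst_continuous|exact: cvg_id].
Qed.

Lemma continuous_sinM (y : R) : continuous (fun u => sin (y * u)).
Proof.
move=> u; apply: (continuous_comp (f := fun u => y * u)); last exact: continuous_sin.
by apply: continuousM; [exact: cst_continuous|exact: cvg_id].
Qed.

Lemma measurable_abel r : measurable_fun setT (abel r).
Proof. by apply: continuous_measurable_fun; exact: continuous_abel. Qed.

Lemma measurable_cosM (y : R) : measurable_fun setT (fun u => cos (y * u)).
Proof. by apply: continuous_measurable_fun; exact: continuous_cosM. Qed.

Lemma measurable_sinM (y : R) : measurable_fun setT (fun u => sin (y * u)).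
Proof. by apply: continuous_measurable_fun; exact: continuous_sinM. Qed.

(** The summand 1 makes the integrand nonnegative, so that the integral over the
    half-line is the limit of an explicit primitive. *)
Lemma integral0y_expR_1Dcos (r y : R) : 0 < r ->
  (\int[mu]_(u in `[0%R, +oo[) (expR (- r * u) * (1 + cos (y * u)))%:E =
  (r^-1 + r / (r ^+ 2 + y ^+ 2))%:E)%E.
Proof.
move=> r0.
have ry0 : 0 < r ^+ 2 + y ^+ 2 by rewrite ltr_wpDr ?sqr_ge0 ?exprn_gt0.
(* [F] is the primitive of [expR (- r * u) * (1 + cos (y * u))] that vanishes at infinity. *)
pose B u := (y * sin (y * u) - r * cos (y * u)) / (r ^+ 2 + y ^+ 2) - r^-1.
pose F u := expR (- r * u) * B u.
have dF (x : R) : is_derive x 1 F (expR (- r * x) * (1 + cos (y * x))).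
  rewrite /F /B; apply: is_derive_eq.
  rewrite /GRing.scale /=; field.
  by rewrite !gt_eqF.
have F0 : F 0 = - (r^-1 + r / (r ^+ 2 + y ^+ 2)).
  rewrite /F /B !mulr0 expR0 sin0 cos0; field.
  by rewrite !gt_eqF.
have Fy : F u @[u --> +oo] --> (0 : R).
  pose C := (`|y| + r) / (r ^+ 2 + y ^+ 2) + r^-1.
  have E0 : expR (- (r * u)) @[u --> +oo] --> (0 : R).
    rewrite (_ : (fun u => expR (- (r * u))) =
      (fun z => expR (- z)) \o (fun z => r * z))//.
    apply: (@cvg_comp _ _ _ _ _ _ (pinfty_nbhs R)); last exact: cvgr_expR.
    exact: gt0_cvgMry.
  have BC u : `|B u| <= C.
    rewrite /B /C (le_trans (ler_normB _ _))// lerD//; last by rewrite gtr0_norm ?invr_gt0.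
    rewrite normrM [X in _ * X]gtr0_norm ?invr_gt0// ler_pM2r ?invr_gt0//.
    rewrite (le_trans (ler_normB _ _))// !normrM (gtr0_norm r0).
    by rewrite lerD// -[leRHS]mulr1 ler_wpM2l ?(ltW r0)//
      ?ler_norml ?sin_geN1 ?sin_le1 ?cos_geN1 ?cos_le1.
  apply: (@squeeze_cvgr _ _ _ _ (fun u => - (expR (- (r * u)) * C))
     (fun u => expR (- (r * u)) * C)).
  - apply: nearW => u; rewrite -ler_norml /F normrM ger0_norm ?expR_ge0//.
    by rewrite mulNr ler_wpM2l ?expR_ge0.
  - by rewrite -oppr0; apply: cvgN; rewrite -(mul0r C); apply: cvgMl.
  - by rewrite -(mul0r C); apply: cvgMl.
have cf : continuous (fun u => expR (- r * u) * (1 + cos (y * u))).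
  move=> u; apply: (@continuousM _ _ (fun u => expR (- r * u)) (fun u => 1 + cos (y * u)));
    last first.
    by apply: continuousD; [exact: cst_continuous|exact: continuous_cosM].
  apply: (continuous_comp (f := fun u => - r * u)); last exact: continuous_expR.
  by apply: continuousM; [exact: cst_continuous|exact: cvg_id].
have dF' (x : R) : derivable F x 1 by have [] := dF x.
rewrite (@ge0_continuous_FTC2y _ _ F _ 0)//.
- by rewrite F0 EFinN oppeK add0e.
- exact: continuous_subspaceT.
- apply: cvg_at_right_filter; apply: differentiable_continuous.
  exact/derivable1_diffP.
- by move=> x _; rewrite derive1E; have [_ ->] := dF x.
Qed.

Lemma integral_abel_1Dcos (r y : R) : 0 < r ->
  (\int[mu]_u (abel r u * (1 + cos (y * u)))%:E =
  (2 * (r^-1 + r / (r ^+ 2 + y ^+ 2)))%:E)%E.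
Proof.
move=> r0; rewrite ge0_symfun_integralT.
- rewrite EFinM -integral0y_expR_1Dcos// set_itvcy; congr *%E.
  by apply: eq_integral => u; rewrite inE/= => u0; rewrite /abel ger0_norm.
- by move=> u; rewrite mulr_ge0 ?expR_ge0.
- move=> u; apply: continuousM; first exact: continuous_abel.
  by apply: continuousD; [exact: cst_continuous|exact: continuous_cosM].
- by move=> u; rewrite /abel /= normrN mulrN cosN.
Qed.

Lemma integrable_abel (r : R) : 0 < r -> mu.-integrable setT (EFin \o abel r).
Proof.
move=> r0; apply/integrableP; split.
  apply/measurable_EFinP; exact: measurable_abel.
apply: (@le_lt_trans _ _ (\int[mu]_u (abel r u * (1 + cos (0 * u)))%:E)%E).
  apply: ge0_le_integral => //=.
  - apply/measurable_EFinP; apply: measurableT_comp => //.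
    exact: measurable_abel.
  - apply/measurable_EFinP; apply: measurable_funM.
      exact: measurable_abel.
    apply: measurable_funD => //.
    exact: measurable_cosM.
  - move=> u _; rewrite lee_fin mul0r cos0 ger0_norm ?expR_ge0//.
    by rewrite ler_peMr ?expR_ge0// lerDl.
by rewrite integral_abel_1Dcos// ltry.
Qed.

Lemma integrable_abelM (r : R) (g : R -> R) : 0 < r -> measurable_fun setT g ->
  (forall u, `|g u| <= 1) -> mu.-integrable setT (EFin \o (fun u => abel r u * g u)).
Proof.
move=> r0 mg g1; apply: le_integrable (integrable_abel r0) => //.
  apply/measurable_EFinP; apply: measurable_funM => //.
  exact: measurable_abel.
by move=> u _; rewrite lee_fin normrM ler_piMr.
Qed.

Lemma norm_cos_le1 (x : R) : `|cos x| <= 1.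
Proof. by rewrite ler_norml cos_geN1 cos_le1. Qed.

Lemma norm_sin_le1 (x : R) : `|sin x| <= 1.
Proof. by rewrite ler_norml sin_geN1 sin_le1. Qed.

Lemma integrable_abel_cos (r y : R) : 0 < r ->
  mu.-integrable setT (EFin \o (fun u => abel r u * cos (y * u))).
Proof.
move=> r0; apply: integrable_abelM => // [|u]; last exact: norm_cos_le1.
exact: measurable_cosM.
Qed.

Lemma integrable_abel_sin (r y : R) : 0 < r ->
  mu.-integrable setT (EFin \o (fun u => abel r u * sin (y * u))).
Proof.
move=> r0; apply: integrable_abelM => // [|u]; last exact: norm_sin_le1.
exact: measurable_sinM.
Qed.

(** The integral with [1 + cos] is known for every frequency; its value at frequency
    0 is twice the integral of [abel r], which is then subtracted. *)
Lemma Rintegral_abel_cos (r y : R) : 0 < r ->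
  Rintegral mu setT (fun u => abel r u * cos (y * u)) = 2 * r / (r ^+ 2 + y ^+ 2).
Proof.
move=> r0.
have ry0 : 0 < r ^+ 2 + y ^+ 2 by rewrite ltr_wpDr ?sqr_ge0 ?exprn_gt0.
have H z : Rintegral mu setT (abel r) + Rintegral mu setT (fun u => abel r u * cos (z * u)) =
    2 * (r^-1 + r / (r ^+ 2 + z ^+ 2)).
  rewrite -RintegralD//; [|exact: integrable_abel|exact: integrable_abel_cos].
  rewrite /Rintegral -[RHS]/(fine (2 * (r^-1 + r / (r ^+ 2 + z ^+ 2)))%:E).
  rewrite -integral_abel_1Dcos//; congr fine.
  by apply: eq_integral => u _; rewrite mulrDr mulr1.
have := H y; have := H 0.
rewrite [X in _ + X](_ : _ = Rintegral mu setT (abel r)); last first.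
  by apply: eq_Rintegral => u _; rewrite mul0r cos0 mulr1.
rewrite expr0n/= addr0 (_ : r / r ^+ 2 = r^-1); last by field; rewrite gt_eqF.
move=> h0 h1; have I0 : Rintegral mu setT (abel r) = 2 * r^-1 by lra.
by move: h1; rewrite I0 mulrDr => /addrI ->; rewrite mulrA.
Qed.

(** The function [abel r u * (1 + sin (y * u))] is nonnegative and its reflection is
    [abel r u * (1 - sin (y * u))]: both have the same integral. *)
Lemma Rintegral_abel_sin (r y : R) : 0 < r ->
  Rintegral mu setT (fun u => abel r u * sin (y * u)) = 0.
Proof.
move=> r0; pose f u := abel r u * (1 + sin (y * u)).
have f0 u : 0 <= f u.
  by rewrite mulr_ge0 ?expR_ge0.
have cf : continuous f.
  move=> u; apply: continuousM; first exact: continuous_abel.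
  by apply: continuousD; [exact: cst_continuous|exact: continuous_sinM].
have /(congr1 fine) := integralT_opp f0 cf.
rewrite -[LHS]/(Rintegral mu setT (fun u => f (- u))) -[RHS]/(Rintegral mu setT f).
rewrite (_ : (fun u => f (- u)) = fun u => abel r u - abel r u * sin (y * u)); last first.
  by apply/funext => u; rewrite /f /abel normrN mulrN sinN; ring.
rewrite (_ : f = fun u => abel r u + abel r u * sin (y * u)); last first.
  by apply/funext => u; rewrite /f; ring.
rewrite RintegralB//; [|exact: integrable_abel|exact: integrable_abel_sin].
rewrite RintegralD//; [|exact: integrable_abel|exact: integrable_abel_sin].
move: (Rintegral _ _ _) (Rintegral _ _ _) => a b; clear; lra.
Qed.

End AbelKernel.

(** * Quaternion exponentials and the Poisson kernel *)

Section QuaternionExponential.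
Variable R : realType.
Notation mu := (@lebesgue_measure R).
Implicit Types e : quaternion R.

(** Common form of [expi] and [expj], which are the cases [e = qi] and [e = qj]. *)
Definition qexp e (theta : R) : quaternion R := (cos theta)%:A + sin theta *: e.

Lemma qcoord_qexp k e theta :
  qcoord k (qexp e theta) = cos theta * qcoord k 1 + sin theta * qcoord k e.
Proof. by rewrite qcoordD !qcoordZ. Qed.

Lemma qexpD e a b : e * e = -1 -> qexp e (a + b) = qexp e a * qexp e b.
Proof.
move=> ee; rewrite /qexp cosD sinD mulrDl !mulrDr -!scalerAl -!scaleqAr !mul1r mulr1 ee.
rewrite !scalerA scalerN scalerBl scalerDl -!addrA; congr (_ + _).
by rewrite [LHS]addrC [RHS]addrA; congr (_ - _); exact: addrC.
Qed.

Lemma qmeasurable_qexp d (T : measurableType d) e (g : T -> R) :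
  measurable_fun setT g -> qmeasurable (fun x => qexp e (g x)).
Proof.
move=> mg k; under eq_fun do rewrite qcoord_qexp.
have mcos : measurable_fun setT (@cos R).
  by apply: continuous_measurable_fun; exact: continuous_cos.
have msin : measurable_fun setT (@sin R).
  by apply: continuous_measurable_fun; exact: continuous_sin.
by apply: measurable_funD; apply: measurable_funM => //; exact: measurableT_comp.
Qed.

Lemma qbounded_qexp d (T : measurableType d) e (g : T -> R) : qbounded (fun x => qexp e (g x)).
Proof.
exists (\sum_k (`|qcoord k (1 : quaternion R)| + `|qcoord k e|)) => k x.
rewrite (bigD1 k)//= ler_wpDr ?sumr_ge0//.
rewrite qcoord_qexp (le_trans (ler_normD _ _))//.
by apply: lerD; rewrite normrM ler_piMl ?norm_cos_le1 ?norm_sin_le1.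
Qed.

(** Up to the factor [2 * pi], the Poisson kernel of the upper half-plane at height
    [r]. *)
Definition poisson (r y : R) : R := 2 * r / (r ^+ 2 + y ^+ 2).

Lemma qintegrable_abel_qexp e r y : 0 < r ->
  qintegrable mu (fun u => abel r u *: qexp e (y * u)).
Proof.
move=> r0 k.
rewrite (_ : (fun u => _) = (fun u => abel r u * cos (y * u) * qcoord k (1 : quaternion R) +
   abel r u * sin (y * u) * qcoord k e)); last first.
  by apply/funext => u; rewrite qcoordZ qcoord_qexp mulrDr !mulrA.
have ? := integrable_abel_cos y r0; have ? := integrable_abel_sin y r0.
by apply: integrable_EFinD; exact: integrable_EFinZr.
Qed.

(** The component along [e] is a sine transform, which vanishes; what remains is
    real, hence central in the quaternions. *)
Lemma qint_abel_qexp e r y : 0 < r ->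
  qint mu (fun u => abel r u *: qexp e (y * u)) = (poisson r y)%:A.
Proof.
move=> r0; apply: qcoord_inj => k; rewrite qcoord_qint qcoordZ.
rewrite (_ : (fun u => _) = (fun u => abel r u * cos (y * u) * qcoord k (1 : quaternion R) +
   abel r u * sin (y * u) * qcoord k e)); last first.
  by apply/funext => u; rewrite qcoordZ qcoord_qexp mulrDr !mulrA.
have ci := integrable_abel_cos y r0; have si := integrable_abel_sin y r0.
rewrite RintegralD//; [|exact: integrable_EFinZr|exact: integrable_EFinZr].
by rewrite !RintegralZr// Rintegral_abel_cos// Rintegral_abel_sin// mul0r addr0.
Qed.

Lemma poisson_ge0 (r y : R) : 0 < r -> 0 <= poisson r y.
Proof.
by move=> r0; rewrite divr_ge0 ?addr_ge0 ?sqr_ge0// mulr_ge0// ltW.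
Qed.

Lemma poisson_le (r y : R) : 0 < r -> poisson r y <= 2 / r.
Proof.
move=> r0; have ry0 : 0 < r ^+ 2 + y ^+ 2 by rewrite ltr_wpDr ?sqr_ge0 ?exprn_gt0.
rewrite ler_pdivrMr// (_ : 2 * r = 2 / r * r ^+ 2); last by field; rewrite gt_eqF.
by rewrite ler_pM2l ?divr_gt0// lerDl sqr_ge0.
Qed.

Lemma continuous_poisson (r : R) : 0 < r -> continuous (poisson r).
Proof.
move=> r0 y; apply: cvgM; first exact: cvg_cst.
apply: cvgV; first by rewrite gt_eqF// ltr_wpDr ?sqr_ge0 ?exprn_gt0.
by apply: cvgD; [exact: cvg_cst|rewrite expr2; apply: cvgM; exact: cvg_id].
Qed.

Lemma measurable_poisson (r : R) : 0 < r -> measurable_fun setT (poisson r).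
Proof. by move=> r0; apply: continuous_measurable_fun; exact: continuous_poisson. Qed.

(** The function [fun s => 2 * atan ((s - x) / r)] is a primitive of the integrand. *)
Lemma Rintegral_poisson_itv (r a b x : R) : 0 < r -> a < b ->
  Rintegral mu `]a, b] (fun s => poisson r (s - x)) =
  2 * (atan ((b - x) / r) - atan ((a - x) / r)).
Proof.
move=> r0 ab; pose F s := 2 * atan ((s - x) / r).
have dF (s : R) : is_derive s 1 F (poisson r (s - x)).
  rewrite /F; apply: is_derive_eq.
  rewrite /GRing.scale /= /poisson; field.
  by rewrite !gt_eqF ?ltr_wpDr ?sqr_ge0 ?exprn_gt0 ?addr_gt0.
have dF' (s : R) : derivable F s 1 by have [] := dF s.
have cF (s : R) : {for s, continuous F}.
  by apply: differentiable_continuous; exact/derivable1_diffP.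
have cp : continuous (fun s => poisson r (s - x)).
  move=> s; apply: (continuous_comp (f := fun s => s - x)); last exact: continuous_poisson.
  by apply: cvgB; [exact: cvg_id|exact: cvg_cst].
rewrite /Rintegral integral_itv_obnd_cbnd; last first.
  by apply/measurable_EFinP/measurable_funTS; exact: continuous_measurable_fun.
rewrite (@continuous_FTC2 _ _ F)//.
- by rewrite -EFinB/= /F mulrBr.
- exact: continuous_subspaceT.
- by split => //; [apply: cvg_at_right_filter|apply: cvg_at_left_filter]; exact: cF.
- by move=> s _; rewrite derive1E; have [_ ->] := dF s.
Qed.

Lemma Rintegral_indic_poisson (r a b x : R) : 0 < r -> a < b ->
  Rintegral mu setT (fun s => \1_(`]a, b]%classic) s * poisson r (s - x)) =
  2 * (atan ((b - x) / r) - atan ((a - x) / r)).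
Proof.
by move=> r0 ab; rewrite -(Rintegral_poisson_itv _ r0 ab); exact: Rintegral_indicM.
Qed.

Lemma cvg_atan_scaled (y : R) : y != 0 ->
  atan (y / (n.+1%:R)^-1) @[n --> \oo] --> Num.sg y * (pi / 2).
Proof.
have pos (z : R) : 0 < z -> atan (z / (n.+1%:R)^-1) @[n --> \oo] --> (pi / 2 : R).
  move=> z0; apply: (@cvg_comp _ _ _ (fun n => z / (n.+1%:R)^-1) (@atan R) _ (pinfty_nbhs R));
    last exact: cvgy_atan.
  apply/cvgryPge => A; near=> n; rewrite invrK mulrC -ler_pdivrMr//.
  rewrite (@le_trans _ _ n%:R)// ?ler_nat//.
  by near: n; exact: nbhs_infty_ger.
case: ltrgt0P => // y0 _.
- by rewrite gtr0_sg// mul1r; exact: pos.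
- rewrite ltr0_sg// mulN1r.
  rewrite (_ : (fun n => _) = fun n => - atan (- y / (n.+1%:R)^-1)); last first.
    by apply/funext => n; rewrite mulNr atanN opprK.
  by apply: cvgN; apply: pos; rewrite oppr_gt0.
Unshelve. all: by end_near. Qed.

(** Each arctangent tends to [pi / 2] or [- (pi / 2)] according to the sign of its
    argument; the two signs differ exactly when [x] lies between [a] and [b]. *)
Lemma cvg_smoothed_indic (a b x : R) : a < b -> x != a -> x != b ->
  2 * (atan ((b - x) / (n.+1%:R)^-1) - atan ((a - x) / (n.+1%:R)^-1)) @[n --> \oo]
  --> \1_(`]a, b]%classic) x * (2 * pi).
Proof.
move=> ab xa xb.
have xa0 : a - x != 0 by rewrite subr_eq0 eq_sym.
have xb0 : b - x != 0 by rewrite subr_eq0 eq_sym.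
rewrite (_ : \1_(_) x * (2 * pi) = 2 * (Num.sg (b - x) * (pi / 2) - Num.sg (a - x) * (pi / 2))).
  by apply: cvgMr; apply: cvgB; exact: cvg_atan_scaled.
rewrite indicE mem_setE in_itv/=.
move: xa xb; rewrite neq_lt => /orP[xa|ax]; rewrite neq_lt => /orP[xb|bx].
- rewrite ltNge (ltW xa)/= mul0r !gtr0_sg ?subr_gt0//; lra.
- by have := lt_trans (lt_trans xa ab) bx; rewrite ltxx.
- by rewrite ax (ltW xb) mul1r gtr0_sg ?subr_gt0// ltr0_sg ?subr_lt0//; field.
- rewrite (lt_geF bx) andbF mul0r !ltr0_sg ?subr_lt0//; lra.
Qed.

End QuaternionExponential.

(** * Functions with the same integrals over rectangles *)

Section MeasurableRectangles.
Context d1 d2 (X : measurableType d1) (Y : measurableType d2).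

(** Since the whole spaces are generators, the preimage of a generator under a
    projection is again a rectangle on generators. *)
Lemma measurable_prod_generators (G1 : set (set X)) (G2 : set (set Y)) :
  @measurable _ X = <<s G1 >> -> @measurable _ Y = <<s G2 >> ->
  G1 setT -> G2 setT ->
  @measurable _ (X * Y)%type = <<s [set A `*` B | A in G1 & B in G2] >>.
Proof.
move=> G1E G2E G1T G2T; set G := [set A `*` B | A in G1 & B in G2].
rewrite eqEsubset; split; last first.
  apply: smallest_sub; first exact: sigma_algebra_measurable.
  move=> _ [A G1A] [B G2B] <-; apply: measurableX.
  - by rewrite G1E; exact: sub_sigma_algebra.
  - by rewrite G2E; exact: sub_sigma_algebra.
apply: smallest_sub; first exact: smallest_sigma_algebra.
rewrite subUset G1E G2E -!g_sigma_preimageE.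
split; apply: smallest_sub; try exact: smallest_sigma_algebra.
- move=> _ [A G1A <-]; apply: sub_sigma_algebra; exists A => //; exists setT => //.
  by apply/seteqP; split => -[x y] /= [].
- move=> _ [B G2B <-]; apply: sub_sigma_algebra; by exists setT => //; exists B.
Qed.

End MeasurableRectangles.

Section LebesgueMeasureOnThePlane.
Variable R : realType.

(** The measure underlying [leb2], named so that it can carry a sigma-finite
    structure and serve as a factor in Fubini's theorem on the product of two
    planes. *)
Definition lebesgue2 := (@lebesgue_measure R \x @lebesgue_measure R)%E.

HB.instance Definition _ := Measure.on lebesgue2.

Definition segment (n : nat) : set (measurableTypeR R) :=
  `](- n.+1%:R), n.+1%:R]%classic.

Definition square n : set (measurableTypeR R * measurableTypeR R) :=
  segment n `*` segment n.

Lemma measurable_square n : measurable (square n).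
Proof. by apply: measurableX; exact: measurable_itv. Qed.

Lemma lebesgue2_square_lty n : (lebesgue2 (square n) < +oo)%E.
Proof.
have I_lty : (lebesgue_measure (segment n) < +oo)%E.
  by rewrite /segment lebesgue_measure_itv/=; case: ifP => // _; rewrite -EFinB ltry.
rewrite /lebesgue2 product_measure1E; [|exact: measurable_itv|exact: measurable_itv].
by rewrite lte_mul_pinfty// ge0_fin_numE.
Qed.

Lemma mem_square (z : measurableTypeR R * measurableTypeR R) :
  exists n, square n z.
Proof.
case: z => x y; exists (Num.truncn (Num.max `|x| `|y|)).
by split; rewrite /segment /= in_itv/=;
  have := truncnS_gt (Num.max `|x| `|y|); rewrite gt_max !ltr_norml;
  move=> /andP[/andP[nx xn] /andP[ny yn]]; rewrite ?nx ?ny /= ltW.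
Qed.

Lemma sigma_finite_lebesgue2 : sigma_finite setT lebesgue2.
Proof.
exists square => [|n]; last by split; [exact: measurable_square|exact: lebesgue2_square_lty].
by apply/seteqP; split => // z _; have [n zn] := mem_square z; exists n.
Qed.

HB.instance Definition _ :=
  Measure_isSigmaFinite.Build _ _ _ lebesgue2 sigma_finite_lebesgue2.

End LebesgueMeasureOnThePlane.
Arguments lebesgue2 : clear implicits.

Section UniquenessOnRectangles.
Variable R : realType.

(** A pi-system that generates the Borel sets, contains the whole line, and whose
    members cut a half-open segment in half-open segments. *)
Definition rays : set (set R) := [set setT] `|` [set `]a, +oo[%classic | a in [set: R]].

Lemma measurable_rays : @measurable _ (measurableTypeR R) = <<s rays >>.
Proof.
rewrite eqEsubset; split.
  rewrite [X in X `<=` _](RGenOInfty.measurableE R).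
  apply: smallest_sub; first exact: smallest_sigma_algebra.
  by move=> _ [a ->]; apply: sub_sigma_algebra; right; exists a.
apply: smallest_sub; first exact: sigma_algebra_measurable.
by move=> _ [->|[a _ <-]]; [exact: measurableT|exact: measurable_itv].
Qed.

Lemma setI_closed_rays : setI_closed rays.
Proof.
move=> _ _ [->|[a _ <-]] [->|[b _ <-]].
- by rewrite setIT; left.
- by rewrite setTI; right; exists b.
- by rewrite setIT; right; exists a.
- right; exists (Num.max a b) => //.
  apply/seteqP; split => x /=; rewrite !in_itv/= !andbT gt_max.
    by move=> /andP[].
  by move=> [-> ->].
Qed.

Lemma rays_setI_itv (A : set R) (a b : R) : rays A ->
  exists c, A `&` `]a, b] = `]c, b]%classic.
Proof.
move=> [->|[c _ <-]]; first by exists a; rewrite setTI.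
exists (Num.max c a); apply/seteqP; split => x /=; rewrite !in_itv/= !andbT gt_max.
  by move=> [-> ].
by move=> /andP[/andP[-> ->] ->].
Qed.

(** Inside a bounded square both functions are integrable. The Borel sets on whose
    trace [f - h] has integral 0 are closed under complements and disjoint unions,
    and contain the pi-system of products of [rays], so they are all the Borel sets;
    hence [f = h] almost everywhere in the square. The squares exhaust the plane. *)
Lemma ae_eq_rectangles (f h : measurableTypeR R * measurableTypeR R -> R) :
  (lebesgue2 R).-integrable setT (EFin \o f) -> measurable_fun setT h ->
  (exists C : R, forall x, `|h x| <= C) ->
  (forall a b c d : R, a < b -> c < d ->
    Rintegral (lebesgue2 R) setT (fun x => \1_(`]a, b]%classic `*` `]c, d]%classic) x * f x) =
    Rintegral (lebesgue2 R) setT (fun x => \1_(`]a, b]%classic `*` `]c, d]%classic) x * h x)) ->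
  {ae lebesgue2 R, forall x, f x = h x}.
Proof.
move=> fi mh [C hC] fh.
pose B := @square R.
have mB n : measurable (B n) by exact: measurable_square.
have hi n : (lebesgue2 R).-integrable (B n) (EFin \o h).
  apply: (measurable_bounded_integrable (mB n) (lebesgue2_square_lty R n));
    first exact: measurable_funTS.
  exists C; split; first exact: num_real.
  by move=> D CD x _ /=; rewrite (le_trans (hC x))// ltW.
have fiB n : (lebesgue2 R).-integrable (B n) (EFin \o f).
  exact: (integrableS measurableT).
pose g x := f x - h x.
have gi n : (lebesgue2 R).-integrable (B n) (EFin \o g).
  exact: (integrableB (mB n) (fiB n) (hi n)).
have key n D : measurable D -> (\int[lebesgue2 R]_(x in D `&` B n) (g x)%:E = 0)%E.
  have gen := measurable_prod_generators measurable_rays measurable_rays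
    (or_introl erefl) (or_introl erefl).
  rewrite gen.
  have giS E : measurable E -> E `<=` B n -> (lebesgue2 R).-integrable E (EFin \o g).
    by move=> mE EB; exact: integrableS (gi n).
  have rect A A' : rays A -> rays A' ->
      (\int[lebesgue2 R]_(x in (A `*` A') `&` B n) (g x)%:E = 0)%E.
    move=> rA rA'; rewrite /B /square -setXI.
    have [c Ac] := rays_setI_itv (- n.+1%:R) n.+1%:R rA.
    have [c' Ac'] := rays_setI_itv (- n.+1%:R) n.+1%:R rA'.
    have EB : (A `&` segment n) `*` (A' `&` segment n) `<=` B n.
      by apply: setSX => x [].
    move: EB; rewrite /segment Ac Ac' => EB.
    have [cn|nc] := ltP c n.+1%:R; last first.
      by rewrite set_itv_ge ?set0X ?integral_set0// bnd_simp -leNgt.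
    have [c'n|nc'] := ltP c' n.+1%:R; last first.
      by rewrite [X in _ `*` X]set_itv_ge ?setX0 ?integral_set0// bnd_simp -leNgt.
    have mE : measurable (`]c, n.+1%:R]%classic `*` `]c', n.+1%:R]%classic :
        set (measurableTypeR R * measurableTypeR R)).
      by apply: measurableX; exact: measurable_itv.
    have Efin := integrable_fin_num mE (giS _ mE EB).
    rewrite -[LHS]fineK; last exact: Efin.
    congr EFin.
    rewrite [LHS](@RintegralB _ _ _ _ _ f h mE).
    - by rewrite -[X in X - _]Rintegral_indicM -[X in _ - X]Rintegral_indicM fh// subrr.
    - exact: integrableS (fiB n).
    - exact: integrableS (hi n).
  move: D; apply: (dynkin_induction gen).
  - move=> _ _ [A1 rA1] [B1 rB1] <- [A2 rA2] [B2 rB2] <-; rewrite -setXI.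
    exists (A1 `&` A2); first exact: setI_closed_rays.
    by exists (B1 `&` B2) => //; exact: setI_closed_rays.
  - by rewrite -setXTT; apply: rect; left.
  - by move=> _ [A rA] [A' rA'] <-; exact: rect.
  - move=> S mS S0.
    have : (\int[lebesgue2 R]_(x in [set: _] `&` B n) (g x)%:E = 0)%E.
      by rewrite -setXTT; apply: rect; left.
    rewrite -(setUv S) setIUl integral_setU//=; last 4 first.
    + exact: measurableI.
    + by apply: measurableI => //; exact: measurableC.
    + rewrite -setIUl setUv setTI; exact: measurable_int (gi n).
    + by apply/disj_set2P; rewrite setIACA setICr set0I.
    by rewrite S0 add0e.
  - move=> F mF tF F0; rewrite setI_bigcupl integral_bigcup.
    + by apply: eseries0 => k _ _; exact: F0.
    + by apply: trivIset_setIr.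
    + by move=> k; exact: measurableI.
    + apply: giS; last by move=> x [k _ []].
      by apply: bigcup_measurable => k _; exact: measurableI.
suff H n : ae_eq (lebesgue2 R) (B n) (EFin \o f) (EFin \o h).
  have := ae_foralln H; apply: filterS => z zfh.
  have [n zn] := mem_square z.
  by have [] := zfh n zn.
apply: integral_ae_eq => //; first exact: measurable_int (hi n).
move=> E EB mE.
have fE : (lebesgue2 R).-integrable E (EFin \o f) by exact: integrableS (fiB n).
have hE : (lebesgue2 R).-integrable E (EFin \o h) by exact: integrableS (hi n).
have := key n E mE; rewrite (setIidl EB).
rewrite (integralB_EFin mE fE hE) => /eqP.
rewrite sube_eq ?add0e; first by move/eqP.
- exact: integrable_fin_num.
- by rewrite fin_num_adde_defl// integrable_fin_num.
Qed.

End UniquenessOnRectangles.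


(** * Domination by the modulus *)

Section NormDomination.
Context d (T : measurableType d) (R : realType).
Implicit Types (mu : {measure set T -> \bar R}) (f : T -> quaternion R).

(** With the next two lemmas, this bounds the coordinates of the integrand of the
    inverse transform by the modulus of the transformed function, whatever the
    exponentials are. *)
Lemma norm_qcoord_le k (q : quaternion R) : `|qcoord k q| <= normq q.
Proof.
rewrite -sqrtr_sqr ler_wsqrtr//.
have s (a : R) : 0 <= a ^+ 2 := sqr_ge0 a.
have := (s (q0 q), s (q1 q), s (q2 q), s (q3 q)).
by case: k => [[|[|[|[|]]]]] //= ? [[[]]] ? ? ? ?; rewrite /qcoord/=; lra.
Qed.

Lemma normq_mul_expi (q : quaternion R) theta : normq (q * expi theta) = normq q.
Proof.
congr Num.sqrt; rewrite -[RHS]mulr1 -(cos2Dsin2 theta) /=; ring.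
Qed.

Lemma normq_mul_expj (q : quaternion R) theta : normq (q * expj theta) = normq q.
Proof.
congr Num.sqrt; rewrite -[RHS]mulr1 -(cos2Dsin2 theta) /=; ring.
Qed.

Lemma normqZ (a : R) (q : quaternion R) : 0 <= a -> normq (a *: q) = a * normq q.
Proof.
move=> a0; rewrite -[X in X * _](ger0_norm a0) -sqrtr_sqr -sqrtrM ?sqr_ge0//.
congr Num.sqrt => /=; ring.
Qed.

Lemma measurable_normq f : qmeasurable f -> measurable_fun setT (fun x => normq (f x)).
Proof.
move=> mf; have msqrt : measurable_fun setT (@Num.sqrt R).
  by apply: continuous_measurable_fun; exact: sqrt_continuous.
apply: (measurableT_comp msqrt).
have m k : measurable_fun setT (fun x => qcoord k (f x) ^+ 2).
  by apply: measurable_funX; exact: mf.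
apply: measurable_funD; last exact: (m (Ordinal (isT : (3 < 4)%N))).
apply: measurable_funD; last exact: (m (Ordinal (isT : (2 < 4)%N))).
apply: measurable_funD; last exact: (m (Ordinal (isT : (1 < 4)%N))).
exact: (m ord0).
Qed.

Lemma integrable_normq mu f : qmeasurable f ->
  (\int[mu]_x (normq (f x))%:E < +oo)%E ->
  mu.-integrable setT (EFin \o (fun x => normq (f x))).
Proof.
move=> mf foo; apply/integrableP; split.
  by apply/measurable_EFinP; exact: measurable_normq.
by under eq_integral do rewrite /= ger0_norm ?sqrtr_ge0//.
Qed.

Lemma qintegrable_normq mu f : qmeasurable f ->
  mu.-integrable setT (EFin \o (fun x => normq (f x))) -> qintegrable mu f.
Proof.
move=> mf fi k; apply: le_integrable fi => //; first by apply/measurable_EFinP; exact: mf.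
by move=> x _; rewrite lee_fin (le_trans (norm_qcoord_le _ _))// ler_norm.
Qed.

Lemma qintegrable_scale_bounded mu (a : T -> R) (q : T -> quaternion R) :
  mu.-integrable setT (EFin \o a) -> qmeasurable q -> qbounded q ->
  qintegrable mu (fun x => a x *: q x).
Proof.
move=> ai mq bq; under eq_fun do rewrite -mulr_algl.
apply: qintegrableMr => // k; under eq_fun do rewrite qcoordZ.
exact: integrable_EFinZr.
Qed.

Lemma qint_scale_cst mu (a : T -> R) q : mu.-integrable setT (EFin \o a) ->
  qint mu (fun x => a x *: q) = Rintegral mu setT a *: q.
Proof.
move=> ai; apply: qcoord_inj => k; rewrite qcoord_qint qcoordZ.
by under eq_Rintegral do rewrite qcoordZ; rewrite RintegralZr.
Qed.

End NormDomination.

(** * Abel means of the inverse transform *)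

Section QuaternionFourierInversion.
Variable R : realType.
Local Notation RR := (measurableTypeR R * measurableTypeR R)%type.
Local Notation mu := (@lebesgue_measure R).
Local Notation L2 := (lebesgue2 R).
Implicit Types (f g G : RR -> quaternion R) (z w x : RR).

Lemma scaleqAll (a : R) (p q s : quaternion R) : a *: p * q * s = a *: (p * q * s).
Proof. by rewrite -!scalerAl. Qed.

Definition abel2 (r : R) w : R := abel r w.1 * abel r w.2.

Definition poisson2 (r : R) w : R := poisson r w.1 * poisson r w.2.

(** The integral of the inversion formula, without its constant. *)
Definition inv_QFT G z : quaternion R :=
  qint L2 (fun w => G w * expj (z.2 * w.2) * expi (z.1 * w.1)).

Lemma integrable_abel2 r : 0 < r -> L2.-integrable setT (EFin \o abel2 r).
Proof. by move=> r0; apply: integrable_prodM; exact: integrable_abel. Qed.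

Lemma measurable_abel2 r : measurable_fun setT (abel2 r).
Proof.
by apply: measurable_funM; apply: measurableT_comp => //; exact: measurable_abel.
Qed.

Lemma abel2_ge0 r w : 0 <= abel2 r w.
Proof. by rewrite mulr_ge0 ?expR_ge0. Qed.

Lemma abel2_le1 r w : 0 < r -> abel2 r w <= 1.
Proof.
by move=> r0; rewrite mulr_ile1 ?expR_ge0// expR_le1 mulNr oppr_le0 mulr_ge0// ltW.
Qed.

Lemma qmeasurable_expi d (T : measurableType d) (a : T -> R) :
  measurable_fun setT a -> qmeasurable (fun t => expi (a t)).
Proof. exact: qmeasurable_qexp. Qed.

Lemma qmeasurable_expj d (T : measurableType d) (a : T -> R) :
  measurable_fun setT a -> qmeasurable (fun t => expj (a t)).
Proof. exact: qmeasurable_qexp. Qed.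

Lemma qbounded_expi d (T : measurableType d) (a : T -> R) :
  qbounded (fun t => expi (a t)).
Proof. exact: qbounded_qexp. Qed.

Lemma qbounded_expj d (T : measurableType d) (a : T -> R) :
  qbounded (fun t => expj (a t)).
Proof. exact: qbounded_qexp. Qed.

Lemma qintegrable_phase G z : qintegrable L2 G ->
  qintegrable L2 (fun w => G w * expj (z.2 * w.2) * expi (z.1 * w.1)).
Proof.
move=> Gi; apply: qintegrableMr; [apply: qintegrableMr => //| |exact: qbounded_expi].
- by apply: qmeasurable_expj; apply: measurable_funM.
- exact: qbounded_expj.
- by apply: qmeasurable_expi; apply: measurable_funM.
Qed.

(** The kernel has modulus 1, so the integrand is in general not jointly integrable
    in [(z, w)]; it is after multiplication by [abel2 1 z]. Fubini's theorem then gives a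
    measurable function, from which this factor is removed by multiplying by its
    inverse [abel2 (- 1) z]. *)
Lemma qmeasurable_inv_QFT G : qintegrable L2 G -> qmeasurable (inv_QFT G).
Proof.
move=> Gi.
(* The integrand as a function of the pair [p = (z, w)]. *)
pose Phi (p : RR * RR) :=
  (abel2 1 p.1 *: G p.2) * (expj (p.1.2 * p.2.2) * expi (p.1.1 * p.2.1)).
have Phii : qintegrable (L2 \x L2)%E Phi.
  apply: qintegrableMr; first exact: qintegrable_prodZ (integrable_abel2 ltr01) Gi.
    apply: qmeasurableM; [apply: qmeasurable_expj|apply: qmeasurable_expi];
      by apply: measurable_funM; do 2 apply: measurableT_comp => //.
  by apply: qboundedM; [exact: qbounded_expj|exact: qbounded_expi].
have Pm := qintegrable_measurable (qintegrable_qint1 Phii).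
rewrite (_ : inv_QFT G = fun z => abel2 (- 1) z *: qint L2 (fun w => Phi (z, w))).
  by apply: qmeasurableZ => //; exact: measurable_abel2.
apply/funext => z.
rewrite (_ : (fun w => Phi (z, w)) = fun w =>
    abel2 1 z *: (G w * expj (z.2 * w.2) * expi (z.1 * w.1))); last first.
  by apply/funext => w; rewrite /Phi/= -scalerAl mulrA.
rewrite qintZ; last exact: qintegrable_phase.
rewrite scalerA (_ : abel2 (- 1) z * abel2 1 z = 1) ?scale1r//.
by rewrite /abel2 /abel -!expRD -[RHS]expR0; congr expR; ring.
Qed.

Lemma norm_inv_QFT_le G z k : qmeasurable G ->
  L2.-integrable setT (EFin \o (fun w => normq (G w))) ->
  `|qcoord k (inv_QFT G z)| <= Rintegral L2 setT (fun w => normq (G w)).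
Proof.
move=> mG Gi; have Pi := qintegrable_phase z (qintegrable_normq mG Gi) k.
rewrite qcoord_qint (le_trans (le_normr_Rintegral _ Pi))//.
apply: le_Rintegral => //; first exact: integrable_norm Pi.
by move=> w _; rewrite (le_trans (norm_qcoord_le _ _))// normq_mul_expi normq_mul_expj.
Qed.

Lemma cvg_abel2 w : abel2 (n.+1%:R^-1) w @[n --> \oo] --> (1 : R).
Proof.
rewrite -[X in _ --> X]mulr1; have a1 (u : R) : abel (n.+1%:R^-1) u @[n --> \oo] --> (1 : R).
  have h0 : - (n.+1%:R^-1) * `|u| @[n --> \oo] --> - 0 * `|u|.
    by apply: cvgMl; apply: cvgN; exact: cvg_harmonic.
  rewrite [X in _ --> X](_ : _ = expR (- 0 * `|u|)); last by rewrite oppr0 mul0r expR0.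
  exact: (cvg_comp _ _ h0 (@continuous_expR R _)).
by apply: cvgM; exact: a1.
Qed.

Lemma cvg_inv_QFT_abel G z k : qmeasurable G ->
  L2.-integrable setT (EFin \o (fun w => normq (G w))) ->
  qcoord k (inv_QFT (fun w => abel2 (n.+1%:R^-1) w *: G w) z) @[n --> \oo] -->
  qcoord k (inv_QFT G z).
Proof.
move=> mG Gi; have Pi := qintegrable_phase z (qintegrable_normq mG Gi).
rewrite qcoord_qint; under eq_cvg do rewrite qcoord_qint.
have E n w : qcoord k (abel2 (n.+1%:R^-1) w *: G w * expj (z.2 * w.2) * expi (z.1 * w.1)) =
    abel2 (n.+1%:R^-1) w * qcoord k (G w * expj (z.2 * w.2) * expi (z.1 * w.1)).
  by rewrite scaleqAll qcoordZ.
have mP : measurable_fun setT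
    (fun w => qcoord k (G w * expj (z.2 * w.2) * expi (z.1 * w.1))).
  exact: qintegrable_measurable Pi k.
apply: (dominated_Rintegral (g := fun w => normq (G w))) => //.
- move=> n; under eq_fun do rewrite E.
  by apply: measurable_funM => //; exact: measurable_abel2.
- apply: aeW => w; set c := qcoord k _; rewrite -[c]mul1r.
  rewrite (_ : (fun n => _) = fun n => abel2 (n.+1%:R^-1) w * c).
    by apply: cvgMl; exact: cvg_abel2.
  by apply/funext => n; exact: E.
- move=> n w; rewrite E normrM -[leRHS]mul1r ler_pM//.
    by rewrite ger0_norm ?abel2_ge0// abel2_le1.
  by rewrite (le_trans (norm_qcoord_le _ _))// normq_mul_expi normq_mul_expj.
Qed.

Lemma qint_abel_expi r y : 0 < r ->
  qint mu (fun u => abel r u *: expi (y * u)) = (poisson r y)%:A.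
Proof. exact: qint_abel_qexp. Qed.

Lemma qint_abel_expj r y : 0 < r ->
  qint mu (fun u => abel r u *: expj (y * u)) = (poisson r y)%:A.
Proof. exact: qint_abel_qexp. Qed.

(** The inner integral, over the second frequency, involves only the two adjacent
    [expj] factors and is real; it can be moved out of the product, which brings the
    two [expi] factors together. *)
Lemma qint_abel2_kernel r x z : 0 < r ->
  qint L2 (fun w => abel2 r w *: (expi (- (w.1 * x.1)) * expj (- (w.2 * x.2)) *
    expj (z.2 * w.2) * expi (z.1 * w.1))) =
  (poisson2 r (z.1 - x.1, z.2 - x.2))%:A.
Proof.
move=> r0.
have Hi : qintegrable (mu \x mu)%E (fun w : RR => abel2 r w *: (expi (- (w.1 * x.1)) *
    expj (- (w.2 * x.2)) * expj (z.2 * w.2) * expi (z.1 * w.1))).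
  apply: (qintegrable_scale_bounded (mu := (mu \x mu)%E)); first exact: integrable_abel2.
    do 3 (try apply: qmeasurableM);
      (apply: qmeasurable_expi || apply: qmeasurable_expj);
      try apply: measurableT_comp => //; exact: measurable_funM.
  do 3 (try apply: qboundedM); (exact: qbounded_expi || exact: qbounded_expj).
transitivity (qint (mu \x mu)%E (fun w : RR => abel2 r w *: (expi (- (w.1 * x.1)) *
    expj (- (w.2 * x.2)) * expj (z.2 * w.2) * expi (z.1 * w.1)))); first by [].
rewrite -(qint12_prod Hi).
transitivity (qint mu (fun u => poisson r (z.2 - x.2) *:
    (abel r u *: expi ((z.1 - x.1) * u)))).
  apply: eq_qint => u.
  transitivity (qint mu (fun v => (abel r u *: expi (- (u * x.1))) *
      (abel r v *: expj ((z.2 - x.2) * v)) * expi (z.1 * u))).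
    apply: eq_qint => v /=; rewrite /abel2 /=.
    have -> : (z.2 - x.2) * v = - (v * x.2) + z.2 * v by ring.
    rewrite [expj (_ + _)]qexpD ?qj_sqr// -!scalerAl -!scaleqAr -!scalerAl scalerA.
    by rewrite !mulrA.
  have ji := qintegrable_abel_qexp qj (z.2 - x.2) r0.
  rewrite qint_mulr; last first.
    by apply: qintegrableMl; [exact: ji|exact: qmeasurable_cst|exact: qbounded_cst].
  rewrite qint_mull; last exact: ji.
  rewrite qint_abel_expj// -!scaleqAr mulr1 -!scalerAl; congr (_ *: (_ *: _)).
  have -> : (z.1 - x.1) * u = - (u * x.1) + z.1 * u by ring.
  by rewrite [expi (_ + _)]qexpD ?qi_sqr.
rewrite qintZ; last exact: qintegrable_abel_qexp.
by rewrite qint_abel_expi// scalerA /poisson2/= mulrC.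
Qed.

Lemma measurable_coords : [/\ measurable_fun setT (fun p : RR * RR => p.1.1),
  measurable_fun setT (fun p : RR * RR => p.1.2),
  measurable_fun setT (fun p : RR * RR => p.2.1) &
  measurable_fun setT (fun p : RR * RR => p.2.2)].
Proof. by split; apply: measurableT_comp. Qed.

Lemma qmeasurable_kernel d (T : measurableType d) (a a' b b' e e' h h' : T -> R) :
  measurable_fun setT a -> measurable_fun setT a' ->
  measurable_fun setT b -> measurable_fun setT b' ->
  measurable_fun setT e -> measurable_fun setT e' ->
  measurable_fun setT h -> measurable_fun setT h' ->
  qmeasurable (fun t => expi (- (a t * a' t)) * expj (- (b t * b' t)) *
    expj (e t * e' t) * expi (h t * h' t)).
Proof.
move=> ma ma' mb mb' me me' mh mh'.
apply: qmeasurableM; last by apply: qmeasurable_expi; exact: measurable_funM.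
apply: qmeasurableM; last by apply: qmeasurable_expj; exact: measurable_funM.
apply: qmeasurableM; [apply: qmeasurable_expi|apply: qmeasurable_expj];
  by apply: measurableT_comp => //; exact: measurable_funM.
Qed.

Lemma qbounded_kernel d (T : measurableType d) (a b e h : T -> R) :
  qbounded (fun t => expi (a t) * expj (b t) * expj (e t) * expi (h t)).
Proof.
apply: qboundedM; last exact: qbounded_expi.
apply: qboundedM; last exact: qbounded_expj.
by apply: qboundedM; [exact: qbounded_expi|exact: qbounded_expj].
Qed.

(** The factor [abel2 r] makes the integrand jointly integrable, so the two
    integrals can be exchanged: the Abel mean of the inverse transform is a
    convolution of [g] with a real kernel. *)
Lemma inv_QFT_abel r g z : 0 < r -> qintegrable L2 g ->
  inv_QFT (fun w => abel2 r w *: right_QFT g w) z =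
  qint L2 (fun x => poisson2 r (z.1 - x.1, z.2 - x.2) *: g x).
Proof.
move=> r0 gi.
(* In [K], [Phi] the first variable is the frequency, the second the position. *)
pose K w x := expi (- (w.1 * x.1)) * expj (- (w.2 * x.2)) *
  expj (z.2 * w.2) * expi (z.1 * w.1).
pose Phi (p : RR * RR) := (abel2 r p.1 *: g p.2) * K p.1 p.2.
have Phii : qintegrable (L2 \x L2)%E Phi.
  apply: qintegrableMr; first exact: qintegrable_prodZ (integrable_abel2 r0) gi.
    by have [? ? ? ?] := measurable_coords; exact: qmeasurable_kernel.
  exact: qbounded_kernel.
transitivity (qint L2 (fun w => qint L2 (fun x => Phi (w, x)))).
  apply: eq_qint => w.
  pose P x := g x * expi (- (w.1 * x.1)) * expj (- (w.2 * x.2)).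
  have Pi : qintegrable L2 P.
    rewrite /P; apply: qintegrableMr; [apply: qintegrableMr => //| |exact: qbounded_expj].
    - apply: qmeasurable_expi; apply: measurableT_comp => //.
      exact: measurable_funM.
    - exact: qbounded_expi.
    - apply: qmeasurable_expj; apply: measurableT_comp => //.
      exact: measurable_funM.
  rewrite scaleqAll (_ : right_QFT g w = qint L2 P)//.
  rewrite -mulrA -qint_mulr// -qintZ; last first.
    by apply: (qintegrableMr Pi); [exact: qmeasurable_cst|exact: qbounded_cst].
  by apply: eq_qint => x; rewrite /Phi/K/P /= -scalerAl !mulrA.
rewrite qFubini//; apply: eq_qint => x.
transitivity (qint L2 (fun w => g x * (abel2 r w *: K w x))).
  by apply: eq_qint => w; rewrite /Phi/= -scalerAl scaleqAr.
rewrite qint_mull; last first.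
  apply: qintegrable_scale_bounded; first exact: integrable_abel2.
    exact: qmeasurable_kernel.
  exact: qbounded_kernel.
by rewrite qint_abel2_kernel// -scaleqAr mulr1.
Qed.

(** The integral of [fun s => poisson r (s - y)] over [`]a, b]], by
    [Rintegral_indic_poisson]. *)
Definition smoothed_indic (r a b y : R) : R :=
  2 * (atan ((b - y) / r) - atan ((a - y) / r)).

Local Notation rect a b c d := (`]a, b]%classic `*` `]c, d]%classic).

Lemma indic_rect (a b c d : R) z :
  \1_(rect a b c d) z = \1_(`]a, b]%classic) z.1 * \1_(`]c, d]%classic) z.2 :> R.
Proof. by rewrite !indicE in_setX; case: (_ \in _); case: (_ \in _); rewrite ?mulr1 ?mulr0. Qed.

Lemma integrable_indic_rect (a b c d : R) :
  L2.-integrable setT (EFin \o (\1_(rect a b c d) : RR -> R)).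
Proof.
rewrite (_ : \1_(rect a b c d) = fun z : RR => \1_(`]a, b]%classic) z.1 * \1_(`]c, d]%classic) z.2).
  by apply: integrable_prodM; exact: integrable_indic_itv.
by apply/funext => z; exact: indic_rect.
Qed.

Lemma integrable_indic_poisson (r a b y : R) : 0 < r ->
  mu.-integrable setT (EFin \o (fun s => \1_(`]a, b]%classic) s * poisson r (s - y))).
Proof.
move=> r0; apply: (@integrableMl _ _ _ mu _ measurableT (EFin \o \1_(`]a, b]%classic))).
- exact: integrable_indic_itv.
- apply: measurableT_comp; first exact: measurable_poisson.
  exact: measurable_funB.
- exists (2 / r); split; first exact: num_real.
  move=> M M2 s _ /=; rewrite ger0_norm ?poisson_ge0//.
  by rewrite (le_trans (poisson_le _ r0))// ltW.
Qed.

Lemma measurable_poisson2B d (T : measurableType d) r (a a' b b' : T -> R) : 0 < r ->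
  measurable_fun setT a -> measurable_fun setT a' ->
  measurable_fun setT b -> measurable_fun setT b' ->
  measurable_fun setT (fun t => poisson2 r (a t - a' t, b t - b' t)).
Proof.
move=> r0 ma ma' mb mb'; apply: measurable_funM;
  (apply: measurableT_comp; first exact: measurable_poisson);
  exact: measurable_funB.
Qed.

Lemma norm_poisson2_le r w : 0 < r -> `|poisson2 r w| <= 2 / r * (2 / r).
Proof. by move=> r0; rewrite normrM ler_pM// ger0_norm ?poisson_ge0// poisson_le. Qed.

(** By Fubini's theorem the indicator of the rectangle, rather than [g], is
    convolved with the Poisson kernels. *)
Lemma qint_rect_inv_QFT_abel (r a b c d : R) g : 0 < r -> a < b -> c < d ->
  qintegrable L2 g ->
  qint L2 (fun z => \1_(rect a b c d) z *:
    inv_QFT (fun w => abel2 r w *: right_QFT g w) z) =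
  qint L2 (fun x => (smoothed_indic r a b x.1 * smoothed_indic r c d x.2) *: g x).
Proof.
move=> r0 ab cd gi; set A := rect a b c d.
pose Psi (p : RR * RR) :=
  poisson2 r (p.1.1 - p.2.1, p.1.2 - p.2.2) *: (\1_A p.1 *: g p.2).
have Psii : qintegrable (L2 \x L2)%E Psi.
  apply: qintegrableZ.
  - exact: qintegrable_prodZ (integrable_indic_rect a b c d) gi.
  - by have [? ? ? ?] := measurable_coords; exact: measurable_poisson2B.
  - by exists (2 / r * (2 / r)) => p; exact: norm_poisson2_le.
transitivity (qint L2 (fun z => qint L2 (fun x => Psi (z, x)))).
  apply: eq_qint => z; rewrite inv_QFT_abel// -qintZ; last first.
    apply: qintegrableZ => //; first exact: measurable_poisson2B.
    by exists (2 / r * (2 / r)) => x; exact: norm_poisson2_le.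
  by apply: eq_qint => x; rewrite /Psi/= !scalerA mulrC.
rewrite qFubini//; apply: eq_qint => x.
transitivity (qint L2 (fun z : RR => ((\1_(`]a, b]%classic) z.1 * poisson r (z.1 - x.1)) *
    (\1_(`]c, d]%classic) z.2 * poisson r (z.2 - x.2))) *: g x)).
  by apply: eq_qint => z; rewrite /Psi/= scalerA /A indic_rect /poisson2 mulrC mulrACA.
have abi := integrable_indic_poisson a b x.1 r0.
have cdi := integrable_indic_poisson c d x.2 r0.
rewrite qint_scale_cst; last exact: (integrable_prodM abi cdi).
congr (_ *: _); rewrite [LHS](Rintegral_prodM abi cdi).
by rewrite !Rintegral_indic_poisson.
Qed.

Lemma ae_fst_neq (a : R) : {ae L2, forall z, z.1 != a}.
Proof.
exists ([set a] `*` setT); split.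
- exact: measurableX.
- by rewrite /lebesgue2 [LHS]product_measure1E// [X in (X * _)%E](lebesgue_measure_set1 a) mul0e.
- by move=> z /negP; rewrite negbK => /eqP.
Qed.

Lemma ae_snd_neq (a : R) : {ae L2, forall z, z.2 != a}.
Proof.
exists (setT `*` [set a]); split.
- exact: measurableX.
- by rewrite /lebesgue2 [LHS]product_measure1E// [X in (_ * X)%E](lebesgue_measure_set1 a) mule0.
- by move=> z /negP; rewrite negbK => /eqP.
Qed.

Lemma measurable_indic_rect (a b c d : R) :
  measurable_fun setT (\1_(rect a b c d) : RR -> R).
Proof. by apply: measurable_indic; apply: measurableX; exact: measurable_itv. Qed.

Lemma qintegrable_abel2Z r G : 0 < r -> qintegrable L2 G ->
  qintegrable L2 (fun w => abel2 r w *: G w).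
Proof.
move=> r0 Gi; apply: qintegrableZ => //; first exact: measurable_abel2.
by exists 1 => w; rewrite ger0_norm ?abel2_ge0// abel2_le1.
Qed.

(** As [abel2 r] is at most 1, the bound is uniform in [r] as well as in [z]: it is
    what makes dominated convergence on a rectangle possible. *)
Lemma norm_inv_QFT_abel_le r G z k : 0 < r -> qmeasurable G ->
  L2.-integrable setT (EFin \o (fun w => normq (G w))) ->
  `|qcoord k (inv_QFT (fun w => abel2 r w *: G w) z)| <=
  Rintegral L2 setT (fun w => normq (G w)).
Proof.
move=> r0 mG Gi.
have le w : normq (abel2 r w *: G w) <= normq (G w).
  by rewrite normqZ ?abel2_ge0// ler_piMl ?sqrtr_ge0// abel2_le1.
have mEG : qmeasurable (fun w => abel2 r w *: G w).
  by apply: qmeasurableZ => //; exact: measurable_abel2.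
have EGi : L2.-integrable setT (EFin \o (fun w => normq (abel2 r w *: G w))).
  apply: le_integrable Gi => //; first by apply/measurable_EFinP; exact: measurable_normq.
  by move=> w _; rewrite lee_fin !ger0_norm ?sqrtr_ge0//; exact: le.
by apply: le_trans (norm_inv_QFT_le z k mEG EGi) _; apply: le_Rintegral.
Qed.

Lemma cvg_rect_inv_QFT_abel (a b c d : R) G k : qmeasurable G ->
  L2.-integrable setT (EFin \o (fun w => normq (G w))) ->
  Rintegral L2 setT (fun z => \1_(rect a b c d) z *
    qcoord k (inv_QFT (fun w => abel2 (n.+1%:R^-1) w *: G w) z)) @[n --> \oo] -->
  Rintegral L2 setT (fun z => \1_(rect a b c d) z * qcoord k (inv_QFT G z)).
Proof.
move=> mG Gi; have Gqi := qintegrable_normq mG Gi.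
apply: (dominated_Rintegral
  (g := fun z => \1_(rect a b c d) z * Rintegral L2 setT (fun w => normq (G w)))).
- move=> n; apply: measurable_funM; first exact: measurable_indic_rect.
  by apply: qmeasurable_inv_QFT; exact: qintegrable_abel2Z.
- apply: measurable_funM; first exact: measurable_indic_rect.
  exact: qmeasurable_inv_QFT.
- by apply: aeW => z; apply: cvgMr; exact: cvg_inv_QFT_abel.
- by apply: integrable_EFinZr; exact: integrable_indic_rect.
- move=> n z; rewrite normrM ger0_norm// ler_wpM2l//.
  exact: norm_inv_QFT_abel_le.
Qed.

Lemma norm_smoothed_indic_le (r a b y : R) : `|smoothed_indic r a b y| <= 2 * pi.
Proof.
rewrite /smoothed_indic normrM ger0_norm// ler_pM2l// ler_norml.
have := (atan_gtNpi2 ((b - y) / r), atan_ltpi2 ((b - y) / r),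
  (atan_gtNpi2 ((a - y) / r), atan_ltpi2 ((a - y) / r))).
by move=> [[? ?] [? ?]]; apply/andP; split; lra.
Qed.

(** Convergence of the integrand can fail only on the four lines that carry the sides
    of the rectangle. *)
Lemma cvg_Rintegral_smoothed_rect (a b c d : R) g k : a < b -> c < d -> qintegrable L2 g ->
  Rintegral L2 setT (fun x => smoothed_indic (n.+1%:R^-1) a b x.1 *
    smoothed_indic (n.+1%:R^-1) c d x.2 * qcoord k (g x)) @[n --> \oo] -->
  Rintegral L2 setT (fun x => \1_(rect a b c d) x * (4 * pi ^+ 2 * qcoord k (g x))).
Proof.
move=> ab cd gi; have mg := qintegrable_measurable gi.
have ms (r p q : R) : measurable_fun setT (smoothed_indic r p q).
  have m p' : measurable_fun setT (fun y : R => atan ((p' - y) / r)).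
    have matan : measurable_fun setT (@atan R).
      by apply: continuous_measurable_fun => u; exact: continuous_atan.
    apply: (measurableT_comp matan); apply: measurable_funM => //.
    exact: measurable_funB.
  by apply: measurable_funM => //; exact: measurable_funB.
apply: (dominated_Rintegral (g := fun x => `|qcoord k (g x)| * (4 * pi ^+ 2))).
- move=> n; apply: measurable_funM; last exact: mg.
  by apply: measurable_funM; apply: measurableT_comp => //; exact: ms.
- apply: measurable_funM; first exact: measurable_indic_rect.
  by apply: measurable_funM => //; exact: mg.
- apply: filterS (filterI (filterI (ae_fst_neq a) (ae_fst_neq b))
    (filterI (ae_snd_neq c) (ae_snd_neq d))) => x [[xa xb] [xc xd]].
  rewrite indic_rect mulrA; apply: cvgMl.
  have -> : \1_(`]a, b]%classic) x.1 * \1_(`]c, d]%classic) x.2 * (4 * pi ^+ 2) =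
    (\1_(`]a, b]%classic) x.1 * (2 * pi)) * (\1_(`]c, d]%classic) x.2 * (2 * pi)) :> R by ring.
  by apply: cvgM; exact: cvg_smoothed_indic.
- by apply: integrable_EFinZr; exact: integrable_norm (gi k).
- move=> n x; rewrite normrM (normrM (smoothed_indic _ _ _ _)) mulrC ler_wpM2l//.
  rewrite (_ : 4 * pi ^+ 2 = 2 * pi * (2 * pi)); last by ring.
  by apply: ler_pM => //; exact: norm_smoothed_indic_le.
Qed.

(** For each coordinate and each rectangle, the integrals of the Abel means have two
    limits, one from the convolution with [g] and one from the integrability of [G];
    their equality is the hypothesis of [ae_eq_rectangles]. *)
Lemma right_QFT_inversion_Borel g G : qintegrable L2 g -> qmeasurable G ->
  L2.-integrable setT (EFin \o (fun w => normq (G w))) ->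
  {ae L2, forall w, right_QFT g w = G w} ->
  {ae L2, forall z, g z = (4 * pi ^+ 2)^-1 *: inv_QFT G z}.
Proof.
move=> gi mG Gi gG.
have pi2 : 0 < 4 * pi ^+ 2 :> R by rewrite mulr_gt0// exprn_gt0// pi_gt0.
have coord k : {ae L2, forall z, qcoord k (g z) =
    qcoord k ((4 * pi ^+ 2)^-1 *: inv_QFT G z)}.
  apply: ae_eq_rectangles.
  - exact: gi.
  - under eq_fun do rewrite qcoordZ; apply: measurable_funM => //.
    by apply: qmeasurable_inv_QFT; exact: qintegrable_normq.
  - exists ((4 * pi ^+ 2)^-1 * Rintegral L2 setT (fun w => normq (G w))) => z.
    rewrite qcoordZ normrM ger0_norm ?invr_ge0 ?(ltW pi2)// ler_pM2l ?invr_gt0//.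
    exact: norm_inv_QFT_le.
  move=> a b c d ab cd.
have mA : measurable (rect a b c d : set RR).
  by apply: measurableX; exact: measurable_itv.
have indic_invi : L2.-integrable setT
    (EFin \o (fun z => \1_(rect a b c d) z * qcoord k (inv_QFT G z))).
  apply: (@integrableMl _ _ _ L2 _ measurableT (EFin \o \1_(rect a b c d))).
  - exact: integrable_indic_rect.
  - by apply: qmeasurable_inv_QFT; exact: qintegrable_normq.
  - exists (Rintegral L2 setT (fun w => normq (G w))); split; first exact: num_real.
    by move=> M IM z _ /=; rewrite (le_trans _ (ltW IM))//; exact: norm_inv_QFT_le.
  have -> : Rintegral L2 setT (fun z => \1_(rect a b c d) z *
      qcoord k ((4 * pi ^+ 2)^-1 *: inv_QFT G z)) = (4 * pi ^+ 2)^-1 *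
      Rintegral L2 setT (fun z => \1_(rect a b c d) z * qcoord k (inv_QFT G z)).
    by rewrite -RintegralZl//; apply: eq_Rintegral => z _; rewrite qcoordZ mulrCA.
  have -> : Rintegral L2 setT (fun z => \1_(rect a b c d) z * qcoord k (inv_QFT G z)) =
     Rintegral L2 setT (fun x => \1_(rect a b c d) x * (4 * pi ^+ 2 * qcoord k (g x))).
    have := @cvg_rect_inv_QFT_abel a b c d G k mG Gi.
    have := @cvg_Rintegral_smoothed_rect a b c d g k ab cd gi.
    rewrite [X in X @ _ --> _ -> _](_ : _ = fun n => Rintegral L2 setT
      (fun z => \1_(rect a b c d) z *
        qcoord k (inv_QFT (fun w => abel2 (n.+1%:R^-1) w *: G w) z))).
      by move=> h1 h2; apply: cvg_unique h2 h1.
    apply/funext => n; have r0 : 0 < n.+1%:R^-1 :> R by rewrite invr_gt0.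
    have := congr1 (qcoord k) (qint_rect_inv_QFT_abel r0 ab cd gi).
    rewrite !qcoord_qint => E.
    transitivity (Rintegral L2 setT (fun x => qcoord k ((smoothed_indic n.+1%:R^-1 a b x.1 *
        smoothed_indic n.+1%:R^-1 c d x.2) *: g x))).
      by apply: eq_Rintegral => x _; rewrite qcoordZ.
    rewrite -E; apply: eq_Rintegral => z _; rewrite qcoordZ; congr (_ * qcoord k _).
    by apply: eq_qint_ae; apply: filterS gG => w ->.
  rewrite -RintegralZl//.
    by apply: eq_Rintegral => x _; rewrite mulrCA mulKf// gt_eqF.
  have gk : L2.-integrable setT (EFin \o (fun x => 4 * pi ^+ 2 * qcoord k (g x))).
    by under eq_fun do rewrite mulrC; exact: integrable_EFinZr (gi k).
  apply: integrable_indicM => //.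
(* Countable intersections of sets of full measure are indexed by [nat]; [inord]
   sends the indices above 3 to the first coordinate. *)
have := @ae_foralln _ _ _ L2 (fun n z => qcoord (inord n) (g z) =
  qcoord (inord n) ((4 * pi ^+ 2)^-1 *: inv_QFT G z)) (fun n => coord (inord n)).
apply: filterS => z gz; apply: qcoord_inj => k.
by have := gz k; rewrite inord_val.
Qed.

End QuaternionFourierInversion.

Lemma measurable_quat_qmeasurable (R : realType)
    (g : measurableTypeR R * measurableTypeR R -> quaternion R) :
  measurable_quat g -> qmeasurable g.
Proof.
by move=> [m0 m1 m2 m3] [[|[|[|[|]]]]].
Qed.

(** The modulus of the Borel representative has the same integral as that of [f],
    hence the representative is integrable. *)
Lemma L1_quat_Borel (R : realType)
    (f : measurableTypeR R * measurableTypeR R -> quaternion R) : L1_quat f ->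
  exists g : measurableTypeR R * measurableTypeR R -> quaternion R,
    [/\ qmeasurable g, {ae lebesgue2 R, forall x, f x = g x} &
      (lebesgue2 R).-integrable setT (EFin \o (fun x => normq (g x)))].
Proof.
move=> [[g mg fg] foo]; have qmg := measurable_quat_qmeasurable mg.
have {}fg : {ae lebesgue2 R, forall x, f x = g x} by exact: fg.
exists g; split => //; apply: integrable_normq => //.
rewrite (@eq_integral_ae _ _ _ (lebesgue2 R) _ (fun x => (normq (f x))%:E)); first exact: foo.
by apply: filterS fg => x ->.
Qed.

Theorem theorem3p6 (R : realType) (f : R * R -> quaternion R)
  (hf : L1_quat f) (hF : L1_quat (right_QFT f)) :
  {ae leb2 R, forall x : R * R,
     f x = (4 * pi ^+ 2)^-1 *: integral_quat (fun w : R * R =>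
             right_QFT f w * expj (x.2 * w.2) * expi (x.1 * w.1))}.
Proof.
have [g [mg fg gi]] := L1_quat_Borel hf.
have [G [mG FG Gi]] := L1_quat_Borel hF.
have Fg w : right_QFT f w = right_QFT g w.
  apply: (@eq_qint_ae _ _ _ (lebesgue2 R)).
  by apply: filterS fg => x ->.
have gG : {ae lebesgue2 R, forall w, right_QFT g w = G w}.
  by apply: filterS FG => w <-; rewrite Fg.
have inv := right_QFT_inversion_Borel (qintegrable_normq mg gi) mG Gi gG.
apply: filterS2 fg inv => x -> ->; congr (_ *: _).
apply: (@eq_qint_ae _ _ _ (lebesgue2 R)).
by apply: filterS FG => w ->.
Qed.
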